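(* Let $X$ be a differentiable Gaussian process on $\mathcal{T}$ with mean function $\mu$, covariance kernel $G$, eigenvalues $\lambda_k$ and eigenfunctions $\phi_k$ as described in the context. Then $$X^{(1)}(t)-\mu^{(1)}(t)=\beta(t)\{X(t)-\mu(t)\}+Z(t),\qquad t\in\mathcal{T},$$ where $$\beta(t)=\frac{\operatorname{cov}\{X^{(1)}(t),X(t)\}}{\operatorname{var}\{X(t)\}}=\frac{\sum_{k=1}^\infty\lambda_k\phi_k^{(1)}(t)\phi_k(t)}{\sum_{k=1}^\infty\lambda_k\phi_k(t)^2}=\frac12\frac{d}{dt}\log[\operatorname{var}\{X(t)\}],\qquad t\in\mathcal{T},$$ and $Z$ is a Gaussian process such that $Z(t)$ and $X(t)$ are independent at each $t\in\mathcal{T}$, and $Z$ is characterized by $E\{Z(t)\}=0$ and $\operatorname{cov}\{Z(t),Z(s)\}=G_z(t,s)$, with $$G_z(t,s)=\sum_{k=1}^\infty\lambda_k\phi_k^{(1)}(t)\phi_k^{(1)}(s)-\beta(t)\sum_{k=1}^\infty\lambda_k\phi_k(t)\phi_k^{(1)}(s)-\beta(s)\sum_{k=1}^\infty\lambda_k\phi_k^{(1)}(t)\phi_k(s)+\beta(t)\beta(s)\sum_{k=1}^\infty\lambda_k\phi_k(t)\phi_k(s).$$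
   Context: $\mathcal{T}$ is a compact interval. $X$ is a square integrable stochastic process on $\mathcal{T}$ with mean function $E\{X(t)\}=\mu(t)$ and auto-covariance function $\operatorname{cov}\{X(t),X(s)\}=G(t,s)$, which is smooth, symmetric and nonnegative definite. The operator $(\mathbf{G}f)(t)=\int_{\mathcal{T}}G(t,s)f(s)\,ds$ has eigenvalues $\lambda_1>\lambda_2>\cdots\ge0$, all of multiplicity one, with orthonormal eigenfunctions $\phi_k$. The process has the Karhunen--Loève representation $X(t)=\mu(t)+\sum_{k\ge1}\xi_k\phi_k(t)$, with $\xi_k=\int_{\mathcal{T}}\{X(t)-\mu(t)\}\phi_k(t)\,dt$ uncorrelated, $E\xi_k=0$, $E\xi_k^2=\lambda_k$, $\sum_k\lambda_k<\infty$. A superscript $(1)$ denotes the first derivative. It is assumed that termwise differentiation is valid: $X^{(1)}(t)=\mu^{(1)}(t)+\sum_{k\ge1}\xi_k\phi_k^{(1)}(t)$ and $\operatorname{cov}\{X^{(\nu_1)}(t),X^{(\nu_2)}(s)\}=\sum_{k\ge1}\lambda_k\phi_k^{(\nu_1)}(t)\phi_k^{(\nu_2)}(s)$ for $\nu_1,\nu_2\in\{0,1\}$, $s,t\in\mathcal{T}$. For a differentiable Gaussian process, $X$ and $X^{(1)}$ are jointly Gaussian processes. It is assumed that $\operatorname{var}\{X(t)\}>0$ for all $t\in\mathcal{T}$. *)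

(* Defs.v *)
From HB Require Import structures.
From mathcomp Require Import all_boot all_order all_algebra.
From mathcomp Require Import all_classical all_reals all_analysis.
Import Order.TTheory GRing.Theory Num.Theory.
Import numFieldNormedType.Exports.

Set Implicit Arguments.
Unset Strict Implicit.
Unset Printing Implicit Defensive.

Local Open Scope classical_set_scope.
Local Open Scope ring_scope.

(* The time domain is T : set R; processes, means and kernels are indexed by
   all of R, but only their values on T are ever constrained or used. *)

(* The limit is taken within T: at an end point of a compact interval the
   derivative is one-sided. *)
Definition has_deriv_on (R : realType) (T : set R) (f : R -> R) (t l : R) :
    Prop :=
  (f s - f t) / (s - t) @[s --> within T t^'] --> l.

(* G, its two first order partial derivatives and its mixed derivative exist
   and are continuous on T * T: the orders needed to make sense of the
   covariances of a process with covariance G and of its first derivative. *)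
Definition smooth_kernel (R : realType) (T : set R) (G : R -> R -> R) : Prop :=
  exists G10 G01 G11 : R -> R -> R,
    [/\ forall t s, T t -> T s ->
          [/\ has_deriv_on T (fun u => G u s) t (G10 t s),
              has_deriv_on T (fun v => G t v) s (G01 t s),
              has_deriv_on T (fun v => G10 t v) s (G11 t s) &
              has_deriv_on T (fun u => G01 u s) t (G11 t s)],
        {within T `*` T, continuous (fun p : R * R => G p.1 p.2)},
        {within T `*` T, continuous (fun p : R * R => G10 p.1 p.2)},
        {within T `*` T, continuous (fun p : R * R => G01 p.1 p.2)} &
        {within T `*` T, continuous (fun p : R * R => G11 p.1 p.2)}].

Definition symmetric_kernel (R : realType) (T : set R) (G : R -> R -> R) :
    Prop :=
  forall t s, T t -> T s -> G t s = G s t.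

Definition nonneg_definite_kernel (R : realType) (T : set R)
    (G : R -> R -> R) : Prop :=
  forall (n : nat) (t c : 'I_n -> R), (forall i, T (t i)) ->
    0 <= \sum_(i < n) \sum_(j < n) c i * c j * G (t i) (t j).

Definition square_integrable_on (R : realType) (T : set R) (f : R -> R) :
    Prop :=
  measurable_fun T f /\
  lebesgue_measure.-integrable T (EFin \o (fun t => f t ^+ 2)).

Definition integral_operator (R : realType) (T : set R) (G : R -> R -> R)
    (f : R -> R) (t : R) : R :=
  \int[lebesgue_measure]_(s in T) (G t s * f s).

(* The last clause says that lambda lists all the nonzero eigenvalues in L^2(T)
   and that each has multiplicity one. *)
Definition simple_spectrum (R : realType) (T : set R) (G : R -> R -> R)
    (lambda : nat -> R) (phi : nat -> R -> R) : Prop :=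
  [/\ forall k, 0 <= lambda k,
      forall k, lambda k.+1 < lambda k,
      forall k, square_integrable_on T (phi k) /\
        (forall t, T t ->
           integral_operator T G (phi k) t = lambda k * phi k t),
      forall j k, \int[lebesgue_measure]_(t in T) (phi j t * phi k t)
                  = (j == k)%:R :> R &
      forall (l : R) (f : R -> R), l != 0 -> square_integrable_on T f ->
        {ae lebesgue_measure, forall t, T t ->
           integral_operator T G f t = l * f t} ->
        ~ {ae lebesgue_measure, forall t, T t -> f t = 0} ->
        exists k, l = lambda k /\
          exists c, {ae lebesgue_measure, forall t, T t -> f t = c * phi k t}].

(* The library's normal_prob m s is the uniform law on [0, 1] when s = 0, so
   the degenerate normal law has to be given separately. *)
Definition normal_law (R : realType) (m s : R) (A : set R) : \bar R :=
  if s == 0 then \d_m A else normal_prob m s A.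

Definition is_normal (d : measure_display) (Omega : measurableType d)
    (R : realType) (P : probability Omega R) (Y : Omega -> R) : Prop :=
  exists m s : R, 0 <= s /\
    forall A : set R, measurable A -> P (Y @^-1` A) = normal_law m s A.

Definition gaussian_process (d : measure_display) (Omega : measurableType d)
    (R : realType) (P : probability Omega R) (T : set R)
    (Y : R -> {RV P >-> R}) : Prop :=
  forall (n : nat) (t c : 'I_n -> R), (forall i, T (t i)) ->
    is_normal P (fun w => \sum_(i < n) c i * Y (t i) w).

Definition independent_RV (d : measure_display) (Omega : measurableType d)
    (R : realType) (P : probability Omega R) (Y Z : {RV P >-> R}) : Prop :=
  forall A B : set R, measurable A -> measurable B ->
    P (Y @^-1` A `&` Z @^-1` B) = (P (Y @^-1` A) * P (Z @^-1` B))%E.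

Definition same_finite_dim_laws (R : realType) (T : set R)
    (d : measure_display) (Omega : measurableType d) (P : probability Omega R)
    (d' : measure_display) (Omega' : measurableType d')
    (P' : probability Omega' R)
    (Y : R -> {RV P >-> R}) (Y' : R -> {RV P' >-> R}) : Prop :=
  forall (n : nat) (t : 'I_n -> R), (forall i, T (t i)) ->
  forall A : set (n.-tuple R), measurable A ->
    P [set w | A [tuple Y (t i) w | i < n]] =
    P' [set w | A [tuple Y' (t i) w | i < n]].

(* Real-valued versions; fine loses nothing on square integrable variables. *)
Definition cov (d : measure_display) (Omega : measurableType d)
    (R : realType) (P : probability Omega R) (Y Z : {RV P >-> R}) : R :=
  fine (covariance P Y Z).

Definition var (d : measure_display) (Omega : measurableType d)
    (R : realType) (P : probability Omega R) (Y : {RV P >-> R}) : R :=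
  fine 'V_P[Y].

Definition mean_square_cvg (d : measure_display) (Omega : measurableType d)
    (R : realType) (P : probability Omega R) (S : nat -> Omega -> R)
    (Y : Omega -> R) : Prop :=
  ('E_P[(fun w => (Y w - S n w) ^+ 2)%R])%E @[n --> \oo] --> 0%E.

(* limn is only meaningful for a convergent series; termwise_derivative below
   includes the convergence of all the series used. *)
Definition ksum (R : realType) (lambda : nat -> R) (f g : nat -> R -> R)
    (t s : R) : R :=
  limn (series (fun k => lambda k * f k t * g k s)).

(* The Karhunen-Loeve representation of X is required in mean square, at each
   t in T. *)
Definition karhunen_loeve (d : measure_display) (Omega : measurableType d)
    (R : realType) (P : probability Omega R) (T : set R)
    (X : R -> {RV P >-> R}) (mu : R -> R) (lambda : nat -> R)
    (phi : nat -> R -> R) (xi : nat -> {RV P >-> R}) : Prop :=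
  [/\ forall k, {ae P, forall w,
        xi k w = \int[lebesgue_measure]_(t in T) ((X t w - mu t) * phi k t)},
      forall k, (xi k : Omega -> R) \in Lfun P 2%:E,
      forall k, 'E_P[xi k]%E = 0%E,
      forall j k, ('E_P[(fun w => xi j w * xi k w)%R])%E
                  = (if j == k then lambda k else 0)%:E &
      forall t, T t ->
        mean_square_cvg P (fun n w => mu t + \sum_(k < n) xi k w * phi k t)
          (X t)].

(* X1, mu1 and phi1 are the first derivatives of X (along almost every sample
   path), mu and phi. *)
Definition termwise_derivative (d : measure_display)
    (Omega : measurableType d) (R : realType) (P : probability Omega R)
    (T : set R) (X X1 : R -> {RV P >-> R}) (mu mu1 : R -> R)
    (lambda : nat -> R) (phi phi1 : nat -> R -> R)
    (xi : nat -> {RV P >-> R}) : Prop :=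
  let Xd (nu : bool) := if nu then X1 else X in
  let phid (nu : bool) := if nu then phi1 else phi in
  [/\ {ae P, forall w, forall t, T t ->
         has_deriv_on T (fun s => X s w) t (X1 t w)},
      forall t, T t -> has_deriv_on T mu t (mu1 t),
      forall k t, T t -> has_deriv_on T (phi k) t (phi1 k t),
      forall t, T t ->
        mean_square_cvg P (fun n w => mu1 t + \sum_(k < n) xi k w * phi1 k t)
          (X1 t) &
      forall (nu1 nu2 : bool) t s, T t -> T s ->
        series (fun k => lambda k * phid nu1 k t * phid nu2 k s) @ \oo -->
        cov (Xd nu1 t) (Xd nu2 s)].

Definition beta (d : measure_display) (Omega : measurableType d)
    (R : realType) (P : probability Omega R) (X X1 : R -> {RV P >-> R})
    (t : R) : R :=
  cov (X1 t) (X t) / var (X t).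

Definition Gz (R : realType) (b : R -> R) (lambda : nat -> R)
    (phi phi1 : nat -> R -> R) (t s : R) : R :=
  ksum lambda phi1 phi1 t s - b t * ksum lambda phi phi1 t s
  - b s * ksum lambda phi1 phi t s + b t * b s * ksum lambda phi phi t s.

(* Main.v *)
Require Import Defs.
From HB Require Import structures.
From mathcomp Require Import all_boot all_order all_algebra.
From mathcomp Require Import all_classical all_reals all_analysis.
From mathcomp Require Import measurable_realfun ring lra.
Import Order.TTheory GRing.Theory Num.Theory.
Import numFieldNormedType.Exports.

Set Implicit Arguments.
Unset Strict Implicit.
Unset Printing Implicit Defensive.

Local Open Scope classical_set_scope.
Local Open Scope ring_scope.

(** The decomposition is a regression of [X1 t] on [X t]. Put
    [Z t = X1 t - mu1 t - beta t * (X t - mu t)]. The value of [beta t] is the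
    one for which [cov (Z t) (X t) = 0]; since [Z t] and [X t] are jointly
    normal, they are then independent. The covariance of [Z] follows by
    bilinearity from the covariances of [X] and [X1], which are given as series
    in the eigenfunctions. What remains rests on two bodies of facts.

    The first is that the pathwise derivative [X1 t] is also the limit in mean
    square of the difference quotients of [X] at [t] ([ms_derivative]). The
    second moment of the difference of two quotients is a combination of mixed
    difference quotients of the covariance kernel, which converge because the
    kernel has a continuous mixed derivative ([mixed_quotient_cvg]), and of
    difference quotients of the mean. So the quotients are Cauchy in mean
    square; letting one of the two points run along a sequence tending to [t],
    Fatou's lemma replaces its quotient by the almost sure limit [X1 t].
    Mean-square limits preserve means, covariances and normality. Hence
    [E X1 t = mu1 t] ([derivative_mean]), the derivative of [var (X t)] is
    [2 cov (X1 t) (X t)] ([variance_derivative]), which makes [beta] half a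
    logarithmic derivative, and finite linear combinations of values of [X] and
    [X1] are normal ([gaussian_with_derivative]), so that [Z] is Gaussian and
    jointly normal with [X] at each time.

    The second is that the law of a random vector [Y] is determined by the
    numbers [E cos (<c, Y> + theta)], real-valued substitutes for the
    characteristic function ([charac_unique]). They determine integrals of
    trigonometric polynomials, and the indicator of an orthant is an iterated
    bounded limit of such polynomials. For a normal variable these numbers
    depend on its mean and variance only ([normal_charac]), by Stein's identity
    and a linear differential equation. Three things follow: a mean-square
    limit of normal variables is normal ([ms_limit_normal]), uncorrelated
    jointly normal variables are independent
    ([uncorrelated_gaussian_independent]), and the mean and covariance of a
    Gaussian process characterize its finite-dimensional laws
    ([same_mean_cov_same_laws]). *)
(** * Integrals of bounded functions *)

Lemma norm_cos_le1 (R : realType) (x : R) : `|cos x| <= 1.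
Proof. by rewrite ler_norml cos_geN1 cos_le1. Qed.

Lemma norm_sin_le1 (R : realType) (x : R) : `|sin x| <= 1.
Proof. by rewrite ler_norml sin_geN1 sin_le1. Qed.

Lemma measurable_cos_comp d (Omega : measurableType d) (R : realType)
    (f : Omega -> R) :
  measurable_fun setT f -> measurable_fun setT (fun w => cos (f w)).
Proof.
by apply: measurableT_comp; exact: continuous_measurable_fun (@continuous_cos R).
Qed.

Section BoundedIntegrals.
Context (R : realType) d (Omega : measurableType d) (P : probability Omega R).

Lemma bounded_integrable (f : Omega -> R) (M : R) :
  measurable_fun setT f -> (forall w, `|f w| <= M) ->
  P.-integrable setT (EFin \o f).
Proof.
move=> mf fM; apply: measurable_bounded_integrable => //.
  exact: fin_num_fun_lty.
exists M; split; first exact: num_real.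
by move=> x Mx w _ /=; rewrite (le_trans (fM w))// ltW.
Qed.

Lemma bounded_cvg_Rintegral (f : nat -> Omega -> R) (g : Omega -> R) (M : R) :
  (forall n, measurable_fun setT (f n)) -> (forall n w, `|f n w| <= M) ->
  (forall w, f ^~ w @ \oo --> g w) ->
  \int[P]_w f n w @[n --> \oo] --> \int[P]_w g w.
Proof.
move=> mf fM fg.
have mg : measurable_fun setT g.
  by apply: (measurable_realfun.measurable_fun_cvg (h := f)) => // w _; exact: fg.
have [ig _ h] : [/\ P.-integrable setT (EFin \o g),
    [sequence \int[P]_w `|(f n w)%:E - (g w)%:E| ]_n @ \oo --> 0%E &
    [sequence \int[P]_w (f n w)%:E ]_n @ \oo --> \int[P]_w (g w)%:E]%E.
  apply: (@dominated_convergence _ _ _ P setT measurableT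
    (fun n w => (f n w)%:E) (EFin \o g) (cst M%:E)) => //.
  - by move=> n; exact/measurable_EFinP.
  - exact/measurable_EFinP.
  - by apply: aeW => w _; apply: cvg_EFin; [exact: nearW|exact: fg].
  - exact: finite_measure_integrable_cst.
  - by apply: aeW => w n _; rewrite lee_fin.
by apply: fine_cvg; rewrite fineK//; exact: integrable_fin_num.
Qed.

Lemma integrable_cos_comp (f : Omega -> R) : measurable_fun setT f ->
  P.-integrable setT (EFin \o (fun w => cos (f w))).
Proof.
move=> mf; apply: (bounded_integrable (M := 1)); first exact: measurable_cos_comp.
by move=> w; exact: norm_cos_le1.
Qed.

Lemma Rintegral_probability_cst (c : R) : \int[P]_w c = c.
Proof.
rewrite Rintegral_cst// -[RHS]mulr1; congr (_ * _).
exact: (congr1 fine (@probability_setT _ _ _ P)).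
Qed.

End BoundedIntegrals.

(** * Trigonometric polynomials *)
Section TrigPolynomials.
Context (R : realType) (n : nat).

(** The phases make sines available, and they make this span of cosines closed
    under products without having to treat sines separately. *)
Inductive trigpoly : (('I_n -> R) -> R) -> Prop :=
| trig_cos c th : trigpoly (fun y => cos (\sum_i c i * y i + th))
| trig_add F G : trigpoly F -> trigpoly G -> trigpoly (fun y => F y + G y)
| trig_scale k F : trigpoly F -> trigpoly (fun y => k * F y).

Lemma trig_ext F G : trigpoly F -> (forall y, F y = G y) -> trigpoly G.
Proof. by move=> tF FG; rewrite (_ : G = F)//; apply/funext => y. Qed.

(** Product-to-sum formula:
    [cos A * cos B = (cos (A + B) + cos (A - B)) / 2]. *)
Lemma trig_mul F G : trigpoly F -> trigpoly G ->
  trigpoly (fun y => F y * G y).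
Proof.
move=> + tG; elim=> {F} [c th|F1 F2 _ t1 _ t2|k F _ tF]; last 2 first.
- by apply: trig_ext (trig_add t1 t2) _ => y; rewrite mulrDl.
- by apply: trig_ext (trig_scale k tF) _ => y; rewrite mulrA.
elim: tG => {G} [c' th'|G1 G2 _ t1 _ t2|k G _ tG]; last 2 first.
- by apply: trig_ext (trig_add t1 t2) _ => y; rewrite mulrDr.
- by apply: trig_ext (trig_scale k tG) _ => y; rewrite mulrCA.
have t1 := trig_cos (fun i => c i + c' i) (th + th').
have t2 := trig_cos (fun i => c i - c' i) (th - th').
apply: trig_ext (trig_scale 2^-1 (trig_add t1 t2)) _ => y.
set A := \sum_i c i * y i + th; set B := \sum_i c' i * y i + th'.
have -> : \sum_i (c i + c' i) * y i + (th + th') = A + B.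
  by under eq_bigr do rewrite mulrDl; rewrite big_split/= addrACA.
have -> : \sum_i (c i - c' i) * y i + (th - th') = A - B.
  under eq_bigr do rewrite mulrBl.
  by rewrite sumrB/= /A /B; ring.
by rewrite cosD cosB; field.
Qed.

Lemma trig_cst k : trigpoly (fun=> k).
Proof.
apply: trig_ext (trig_scale k (trig_cos (fun=> 0) 0)) _ => y.
by rewrite big1 ?addr0 ?cos0 ?mulr1// => i _; rewrite mul0r.
Qed.

Lemma trig_prod (I : Type) (r : seq I) (F : I -> ('I_n -> R) -> R) :
  (forall i, trigpoly (F i)) -> trigpoly (fun y => \prod_(i <- r) F i y).
Proof.
move=> tF; elim: r => [|i r IH].
  by apply: trig_ext (trig_cst 1) _ => y; rewrite big_nil.
by apply: trig_ext (trig_mul (tF i) IH) _ => y; rewrite big_cons.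
Qed.

Lemma trig_bounded F : trigpoly F -> exists M, forall y, `|F y| <= M.
Proof.
elim=> {F} [c th|F G _ [M FM] _ [N GN]|k F _ [M FM]].
- by exists 1 => y; exact: norm_cos_le1.
- by exists (M + N) => y; rewrite (le_trans (ler_normD _ _))// lerD.
- by exists (`|k| * M) => y; rewrite normrM ler_wpM2l.
Qed.

Lemma trig_measurable d (Omega : measurableType d) (Y : 'I_n -> Omega -> R) F :
  (forall i, measurable_fun setT (Y i)) -> trigpoly F ->
  measurable_fun setT (fun w => F (Y ^~ w)).
Proof.
move=> mY; elim=> {F} [c th|F G _ mF _ mG|k F _ mF].
- apply: measurable_cos_comp.
  apply: measurable_funD => //; apply: measurable_sum => i.
  exact: measurable_funM.
- exact: measurable_funD.
- exact: measurable_funM.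
Qed.

End TrigPolynomials.

(** * Half-lines as limits of trigonometric polynomials *)
Section HalfLines.
Context (R : realType).

(** On [[-1, 1]] this cubic fixes [-1], [0] and [1] and moves every other point
    away from [0], so that its iterates turn a number into its sign. *)
Definition sharpen (u : R) : R := u * (3 - u ^+ 2) / 2.

Lemma iter_sharpenN m u : iter m sharpen (- u) = - iter m sharpen u.
Proof. by elim: m => //= m ->; rewrite /sharpen; field. Qed.

(** [1 - sharpen v = (1 - v) * (1 - v / 2 - v ^+ 2 / 2)], where for [v >= u] the
    second factor is at most [1 - u / 2]: the distance to [1] decreases
    geometrically. *)
Lemma iter_sharpen_itv m (u : R) : 0 <= u <= 1 ->
  u <= iter m sharpen u <= 1 /\ 1 - iter m sharpen u <= (1 - u / 2) ^+ m.
Proof.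
move=> /andP[u0 u1]; elim: m => [|m [/andP[ul l1] IH]].
  by rewrite /= lexx u1 expr0; split => //; lra.
set v := iter m sharpen u in ul l1 IH; rewrite iterS -/v exprS /sharpen.
have v0 : 0 <= v by lra.
have e1 : 1 - v * (3 - v ^+ 2) / 2 = (1 - v) * (1 - v / 2 - v ^+ 2 / 2) by field.
have v2 : 0 <= v ^+ 2 <= 1 by rewrite sqr_ge0 expr_le1.
have [v2l v2u] := andP v2; split; last by rewrite e1 mulrC ler_pM//; lra.
have : 0 <= v * (1 - v ^+ 2) by rewrite mulr_ge0// subr_ge0.
have : 0 <= (1 - v) * (1 - v / 2 - v ^+ 2 / 2) by rewrite mulr_ge0//; lra.
by rewrite -e1 => h1 h2; apply/andP; split; lra.
Qed.

Lemma norm_iter_sharpen m u : `|u| <= 1 -> `|iter m sharpen u| <= 1.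
Proof.
move=> u1; have [u0|/ltW u0] := leP 0 u.
  have [/andP[? ?] _] := @iter_sharpen_itv m u ltac:(rewrite u0 -(ger0_norm u0)//).
  by rewrite ger0_norm// (le_trans u0).
have [/andP[ul uu] _] := @iter_sharpen_itv m (- u)
  ltac:(rewrite oppr_ge0 u0 -(ler0_norm u0)//).
by rewrite -normrN -iter_sharpenN ger0_norm// (le_trans _ ul)// oppr_ge0.
Qed.

Lemma cvg_iter_sharpen u : `|u| <= 1 ->
  iter m sharpen u @[m --> \oo] --> Num.sg u.
Proof.
have pos (v : R) : 0 < v -> v <= 1 -> iter m sharpen v @[m --> \oo] --> (1 : R).
  move=> v0 v1; apply/cvgrPdist_le => e e0.
  have : (1 - v / 2) ^+ m @[m --> \oo] --> (0 : R).
    by apply: cvg_expr; rewrite ger0_norm; lra.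
  move=> /cvgrPdist_le/(_ _ e0); apply: filterS => m.
  have [/andP[? ?] h] := @iter_sharpen_itv m v ltac:(rewrite (ltW v0)//).
  rewrite sub0r normrN ger0_norm; last by rewrite exprn_ge0//; lra.
  by move=> /(le_trans h); rewrite ger0_norm// subr_ge0.
move=> u1; have [u0|u0|->] := ltgtP u 0.
- rewrite ltr0_sg// -[u]opprK; under eq_fun do rewrite iter_sharpenN.
  by apply: cvgN; apply: pos; rewrite ?oppr_gt0// -(ltr0_norm u0).
- by rewrite gtr0_sg//; apply: pos => //; rewrite -(gtr0_norm u0).
- rewrite sgr0; under eq_fun => m.
    rewrite (_ : iter m sharpen 0 = 0); first over.
    by elim: m => //= m ->; rewrite /sharpen mul0r mul0r.
  exact: cvg_cst.
Qed.

(** A smooth form of the indicator of [a < x], polynomial in a sine. The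
    quadratic [(v ^+ 2 + v) / 2] sends the signs [-1], [0], [1] to [0], [0], [1],
    so that [m] tending to infinity gives the indicator of
    [0 < sin ((x - a) / L)]; a large period [L] then gives that of [a < x]. *)
Definition above (L a x : R) (m : nat) : R :=
  let v := iter m sharpen (sin ((x - a) / L)) in (v ^+ 2 + v) / 2.

Lemma norm_above L a x m : `|above L a x m| <= 1.
Proof.
rewrite /above; set v := iter _ _ _.
have : `|v| <= 1 by apply: norm_iter_sharpen; exact: norm_sin_le1.
rewrite !ler_norml => /andP[v0 v1].
have : v ^+ 2 <= 1 by rewrite expr2; nra.
have q0 : 0 <= v ^+ 2 by exact: sqr_ge0.
move=> ?; apply/andP; split; lra.
Qed.

Lemma cvg_above L a x :
  above L a x m @[m --> \oo] --> ((0 < sin ((x - a) / L))%R%:R : R).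
Proof.
set u := sin _.
have cu : iter m sharpen u @[m --> \oo] --> Num.sg u.
  by apply: cvg_iter_sharpen; exact: norm_sin_le1.
have -> : (0 < u)%R%:R = (Num.sg u ^+ 2 + Num.sg u) / 2 :> R.
  by have [u0|u0|->] := ltgtP u 0;
    rewrite ?(ltr0_sg u0) ?(gtr0_sg u0) ?sgr0 /=; lra.
apply: cvgM; last exact: cvg_cst.
apply: cvgD => //; rewrite expr2; under eq_fun do rewrite expr2.
exact: cvgM.
Qed.

(** Once [`|x - a| < L * pi], the sine of [(x - a) / L] has the sign of
    [x - a]. *)
Lemma cvg_sin_gt0 (a x : R) :
  ((0 < sin ((x - a) / k.+1%:R))%R%:R : R) @[k --> \oo] --> ((a < x)%R%:R : R).
Proof.
apply: cvg_near_cst; near=> k.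
have k0 : 0 < k.+1%:R :> R by [].
have xk : `|(x - a) / k.+1%:R| < pi.
  rewrite normf_div (gtr0_norm k0) ltr_pdivrMr//.
  have p1 : 1 <= pi :> R by apply: le_trans (pi_ge2 R); lra.
  have : `|x - a| < k.+1%:R.
    near: k; exists (Num.truncn `|x - a|).+1 => // k /= hk.
    by rewrite (lt_le_trans (truncnS_gt _))// ler_nat (leq_trans hk).
  move=> h; apply: (lt_le_trans h); rewrite ler_peMl//; exact: ltW.
have [xa|xa] := ltP a x.
  have q0 : 0 < (x - a) / k.+1%:R by rewrite divr_gt0// subr_gt0.
  by rewrite sin_gt0_pi//; rewrite q0 -(gtr0_norm q0).
have q0 : 0 <= (a - x) / k.+1%:R by rewrite divr_ge0// subr_ge0.
have e : (x - a) / k.+1%:R = - ((a - x) / k.+1%:R) by rewrite -mulNr opprB.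
rewrite e sinN oppr_gt0 ltNge sin_ge0_pi// q0/= ltW//.
by move: xk; rewrite e normrN ger0_norm.
Unshelve. all: by end_near. Qed.

Lemma trig_above n (i : 'I_n) (L a : R) m :
  trigpoly (fun y : 'I_n -> R => above L a (y i) m).
Proof.
have ts : trigpoly (fun y : 'I_n -> R => sin ((y i - a) / L)).
  apply: trig_ext (trig_cos (fun j => (j == i)%:R / L) (- a / L - pi / 2)) _ => y.
  rewrite (bigD1 i)//= eqxx big1 ?addr0; last first.
    by move=> j /negbTE ->; rewrite !mul0r.
  by rewrite -cosBpihalf; congr cos; rewrite /=; ring.
have tv : trigpoly (fun y : 'I_n -> R => iter m sharpen (sin ((y i - a) / L))).
  elim: m => //= m IH; rewrite /sharpen.
  have t3 := trig_add (trig_cst n 3) (trig_scale (-1) (trig_mul IH IH)).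
  apply: trig_ext (trig_scale 2^-1 (trig_mul IH t3)) _ => y.
  by rewrite /=; ring.
apply: trig_ext (trig_scale 2^-1 (trig_add (trig_mul tv tv) tv)) _ => y.
by rewrite /above /=; ring.
Qed.

End HalfLines.

(** * Laws are determined by their cosine transforms *)
Section CharacUnique.
Context (R : realType) (n : nat).
Context d (Omega : measurableType d) (P : probability Omega R).
Context d' (Omega' : measurableType d') (P' : probability Omega' R).
Variables (Y : 'I_n -> Omega -> R) (Y' : 'I_n -> Omega' -> R).
Hypotheses (mY : forall i, measurable_fun setT (Y i))
  (mY' : forall i, measurable_fun setT (Y' i)).
Hypothesis charac_eq : forall (c : 'I_n -> R) th,
  \int[P]_w cos (\sum_i c i * Y i w + th) =
  \int[P']_w cos (\sum_i c i * Y' i w + th).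

Lemma trig_integral_eq F : trigpoly F ->
  \int[P]_w F (Y ^~ w) = \int[P']_w F (Y' ^~ w).
Proof.
have itg d0 (T : measurableType d0) (Q : probability T R) (V : 'I_n -> T -> R) G :
    (forall i, measurable_fun setT (V i)) -> trigpoly G ->
    Q.-integrable setT (EFin \o (fun w => G (V ^~ w))).
  move=> mV tG; have [M GM] := trig_bounded tG.
  by apply: (bounded_integrable _ (M := M)) => //; exact: trig_measurable.
elim=> {F} [c th|F G tF IF tG IG|k F tF IF]; first exact: charac_eq.
- by rewrite !RintegralD//= ?IF ?IG//; exact: itg.
- by rewrite !RintegralZl//= ?IF//; exact: itg.
Qed.

(** Two successive bounded limits starting from products of [above]: first in
    the number of iterations, for a fixed period, then in the period. *)
Lemma orthant_integral_eq (a : 'I_n -> R) :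
  \int[P]_w \prod_i (a i < Y i w)%R%:R = \int[P']_w \prod_i (a i < Y' i w)%R%:R.
Proof.
have prod1 (u : 'I_n -> R) : (forall i, `|u i| <= 1) -> `|\prod_i u i| <= 1.
  move=> u1; rewrite normr_prod; apply: le_trans (_ : \prod_(i < n) 1 <= 1).
    by apply: ler_prod => i _; rewrite normr_ge0 u1.
  by rewrite big1.
have norm01 (b : bool) : `|b%:R : R| <= 1 by case: b; rewrite ?normr1 ?normr0.
have cvgp (u : 'I_n -> nat -> R) (l : 'I_n -> R) :
    (forall i, u i m @[m --> \oo] --> l i) ->
    \prod_i u i m @[m --> \oo] --> \prod_i l i.
  by move=> ul; apply: cvg_big => //; exact: mul_continuous.
pose S L (y : 'I_n -> R) : R := \prod_i (0 < sin ((y i - a i) / L))%R%:R.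
have cvgS L y : \prod_i above L (a i) (y i) m @[m --> \oo] --> S L y.
  by apply: cvgp => i; exact: cvg_above.
have maboves d0 (T : measurableType d0) (V : 'I_n -> T -> R) L m :
    (forall i, measurable_fun setT (V i)) ->
    measurable_fun setT (fun w => \prod_i above L (a i) (V i w) m).
  move=> mV.
  apply: (trig_measurable (F := fun y => \prod_i above L (a i) (y i) m) mV).
  by apply: trig_prod => i; exact: trig_above.
have cvgm d0 (T : measurableType d0) (Q : probability T R) (V : 'I_n -> T -> R) L :
    (forall i, measurable_fun setT (V i)) ->
    \int[Q]_w \prod_i above L (a i) (V i w) m @[m --> \oo] -->
    \int[Q]_w S L (V ^~ w).
  move=> mV; apply: (@bounded_cvg_Rintegral _ _ _ _ _ _ 1) => //.
  - by move=> m; exact: maboves.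
  - by move=> m w; apply: prod1 => i; exact: norm_above.
have SE L : \int[P]_w S L (Y ^~ w) = \int[P']_w S L (Y' ^~ w).
  rewrite -(cvg_lim (@Rhausdorff R) (cvgm _ _ P Y L mY)).
  rewrite -(cvg_lim (@Rhausdorff R) (cvgm _ _ P' Y' L mY')).
  congr (limn _); apply/funext => m.
  apply: (@trig_integral_eq (fun y => \prod_i above L (a i) (y i) m)).
  by apply: trig_prod => i; exact: trig_above.
have cvgL d0 (T : measurableType d0) (Q : probability T R) (V : 'I_n -> T -> R) :
    (forall i, measurable_fun setT (V i)) ->
    \int[Q]_w S k.+1%:R (V ^~ w) @[k --> \oo] -->
    \int[Q]_w \prod_i (a i < V i w)%R%:R.
  move=> mV; apply: (@bounded_cvg_Rintegral _ _ _ _ _ _ 1) => //.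
  - move=> k; apply: (measurable_realfun.measurable_fun_cvg
      (h := fun m w => \prod_i above k.+1%:R (a i) (V i w) m)) => //.
    by move=> m; exact: maboves.
  - by move=> k w; apply: prod1.
  - by move=> w; apply: cvgp => i; exact: cvg_sin_gt0.
rewrite -(cvg_lim (@Rhausdorff R) (cvgL _ _ P Y mY)).
rewrite -(cvg_lim (@Rhausdorff R) (cvgL _ _ P' Y' mY')).
by congr (limn _); apply/funext => k; exact: SE.
Qed.

Lemma orthant_eq (a : 'I_n -> R) :
  P [set w | forall i, a i < Y i w] = P' [set w | forall i, a i < Y' i w].
Proof.
have PE d0 (T : measurableType d0) (Q : probability T R) (V : 'I_n -> T -> R) :
    (forall i, measurable_fun setT (V i)) ->
    Q [set w | forall i, a i < V i w] =
    (\int[Q]_w \prod_i (a i < V i w)%R%:R)%:E.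
  move=> mV; set A := [set w | _].
  have mA : measurable A.
    rewrite (_ : A = \bigcap_(i in [set: 'I_n]) (V i @^-1` `]a i, +oo[)).
      apply: fin_bigcap_measurable => // i _; rewrite -[X in measurable X]setTI.
      exact: mV.
    apply/seteqP; split=> [w Aw i _ /=|w Aw i].
      by rewrite in_itv/= andbT.
    by have := Aw i I; rewrite /= in_itv/= andbT.
  have -> : (fun w => \prod_i (a i < V i w)%R%:R) = \1_A :> (T -> R).
    apply/funext => w; rewrite indicE; have [|] := boolP (w \in A).
      by rewrite inE => Aw; rewrite big1// => i _; rewrite Aw.
    move=> /negP wA; apply/eqP; rewrite prodf_seq_eq0.
    apply/hasP; apply: contrapT => h; apply: wA; rewrite inE => i.
    apply: contrapT => /negP wi; apply: h; exists i => //=.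
      by rewrite mem_index_enum.
    by rewrite (negbTE wi).
  rewrite /Rintegral integral_indic// setIT fineK//.
  exact: fin_num_measure.
by rewrite !PE// orthant_integral_eq.
Qed.

End CharacUnique.

(** A half-space [b < y_i] is the increasing union of the orthants whose other
    bounds are [- k]; half-lines generate the Borel sets of the line, hence
    half-spaces generate the product sigma-algebra. *)
Lemma measurable_tuple_orthants (R : realType) (n : nat) (A : set (n.-tuple R)) :
  measurable A ->
  <<s [set [set y : n.-tuple R | forall i, a i < tnth y i]
        | a in [set: 'I_n -> R]] >> A.
Proof.
set G := (X in <<s X >>).
have coord (i : 'I_n) (b : R) : <<s G >> [set y : n.-tuple R | b < tnth y i].
  rewrite (_ : [set _ | _] = \bigcup_k
      [set y : n.-tuple R | forall j, (if j == i then b else - k%:R) < tnth y j]).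
    apply: sigma_algebra_bigcup => k; apply: sub_sigma_algebra.
    by exists (fun j => if j == i then b else - k%:R).
  apply/seteqP; split=> [y /= yb|y [k _] /(_ i)]; last by rewrite eqxx.
  exists (Num.truncn (\sum_j `|tnth y j|)).+1 => // j.
  have [->//|ji] := eqVneq j i.
  rewrite ltrNl (le_lt_trans (ler_norm _))// normrN (le_lt_trans _ (truncnS_gt _))//.
  by rewrite (bigD1 j)//= lerDl sumr_ge0.
apply: smallest_sub; first exact: smallest_sigma_algebra.
rewrite -bigcup_seq => B [i _] [C mC <-]; rewrite setTI.
have sG : sigma_algebra [set: R]
    (image_set_system setT (fun y : n.-tuple R => tnth y i) <<s G >>).
  by apply: sigma_algebra_image; exact: smallest_sigma_algebra.
have : <<s @RGenOInfty.G R >> C.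
  by move: mC; rewrite -[measurable]/((@ocitv R).-sigma.-measurable) RGenOInfty.measurableE.
move=> /(smallest_sub sG); rewrite /image_set_system/= setTI; apply.
move=> _ [b ->] /=; rewrite setTI.
rewrite (_ : _ @^-1` _ = [set y : n.-tuple R | b < tnth y i]); first exact: coord.
by apply/seteqP; split=> y /=; rewrite in_itv/= andbT.
Qed.

(** Orthants are stable under intersection and generate, so agreement on them
    extends to all measurable sets. *)
Lemma charac_unique (R : realType) (n : nat)
    d (Omega : measurableType d) (P : probability Omega R)
    d' (Omega' : measurableType d') (P' : probability Omega' R)
    (Y : 'I_n -> {RV P >-> R}) (Y' : 'I_n -> {RV P' >-> R}) :
  (forall (c : 'I_n -> R) th,
    \int[P]_w cos (\sum_i c i * Y i w + th) =
    \int[P']_w cos (\sum_i c i * Y' i w + th)) ->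
  forall A : set (n.-tuple R), measurable A ->
    P [set w | A [tuple Y i w | i < n]] = P' [set w | A [tuple Y' i w | i < n]].
Proof.
move=> hcf A mA.
have mT d0 (T : measurableType d0) (Q : probability T R) (V : 'I_n -> {RV Q >-> R}) :
    measurable_fun setT (fun w => [tuple V i w | i < n]).
  apply/measurable_fun_tnthP => i.
  rewrite (_ : _ \o _ = V i)//; apply/funext => w /=; exact: tnth_mktuple.
pose m1 := distribution P (mfun_Sub (mem_set (mT _ _ P Y)) : {RV P >-> n.-tuple R}).
pose m2 := distribution P' (mfun_Sub (mem_set (mT _ _ P' Y')) : {RV P' >-> n.-tuple R}).
change (m1 A = m2 A).
set G := [set [set y : n.-tuple R | forall i, a i < tnth y i]
        | a in [set: 'I_n -> R]].
have mG : G `<=` measurable.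
  move=> _ [a _ <-].
  rewrite (_ : [set y | _] =
      \bigcap_(i in [set: 'I_n]) ((fun y : n.-tuple R => tnth y i) @^-1` `]a i, +oo[)).
    apply: fin_bigcap_measurable => // i _; rewrite -[X in measurable X]setTI.
    exact: measurable_tnth.
  apply/seteqP; split=> [y ya i _ /=|y ya i].
    by rewrite in_itv/= andbT; exact: ya.
  by have := ya i I; rewrite /= in_itv/= andbT.
apply: (@g_sigma_algebra_measure_unique _ _ _ G _
  (fun k => [set y : n.-tuple R | forall i, - k%:R < tnth y i])).
- exact: mG.
- by move=> k; exists (fun=> - k%:R).
- apply/seteqP; split=> // y _; exists (Num.truncn (\sum_j `|tnth y j|)).+1 => // j.
  rewrite ltrNl (le_lt_trans (ler_norm _))// normrN (le_lt_trans _ (truncnS_gt _))//.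
  by rewrite (bigD1 j)//= lerDl sumr_ge0.
- move=> _ _ [a _ <-] [b _ <-]; exists (fun i => Num.max (a i) (b i)) => //.
  apply/seteqP; split=> [y /= yab|y [ya yb] i /=].
    by split=> i; have := yab i; rewrite gt_max => /andP[].
  by rewrite gt_max ya yb.
- move=> _ [a _ <-].
  have E d0 (T : measurableType d0) (Q : probability T R) (V : 'I_n -> {RV Q >-> R}) :
      (fun w => [tuple V i w | i < n]) @^-1` [set y | forall i, a i < tnth y i]
      = [set w | forall i, a i < V i w].
    by apply/seteqP; split=> w /= h i; have := h i; rewrite tnth_mktuple.
  change (P ((fun w => [tuple Y i w | i < n]) @^-1` [set y | forall i, a i < tnth y i])
    = P' ((fun w => [tuple Y' i w | i < n]) @^-1` [set y | forall i, a i < tnth y i])).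
  by rewrite !E; apply: orthant_eq.
- move=> k; rewrite ltey_eq fin_num_measure//.
  by apply: mG; exists (fun=> - k%:R).
- exact: measurable_tuple_orthants.
Qed.

(** * The normal distribution *)
Section NormalMoments.
Context (R : realType) (m s : R).
Hypothesis s0 : s != 0.
Local Notation mu := (@lebesgue_measure R).
Local Notation N := (normal_prob m s).
Local Notation pdf := (normal_pdf m s).

Let mpdf : measurable_fun setT (EFin \o pdf).
Proof. by apply/measurable_EFinP; exact: measurable_normal_pdf. Qed.

(** The normal law is the indefinite integral of [normal_pdf], so the latter is
    its Radon-Nikodym derivative; this turns integrals against the law into
    Lebesgue integrals. *)
Lemma normal_density :
  ae_eq mu setT (Radon_Nikodym_SigmaFinite.f (normal_prob m s) mu) (EFin \o pdf).
Proof.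
have dom := normal_prob_dominates m s.
apply: integral_ae_eq => //.
  exact: Radon_Nikodym_SigmaFinite.f_integrable.
move=> A _ mA; rewrite -Radon_Nikodym_SigmaFinite.f_integral//.
Qed.

Lemma ge0_integral_normal (f : R -> \bar R) :
  measurable_fun setT f -> (forall x, 0 <= f x)%E ->
  (\int[N]_x f x = \int[mu]_x (f x * (pdf x)%:E))%E.
Proof.
move=> mf f0; have dom := normal_prob_dominates m s.
rewrite -(Radon_Nikodym_SigmaFinite.change_of_variables dom)//.
apply: ae_eq_integral => //.
- apply: emeasurable_funM => //; apply: measurable_int.
  exact: Radon_Nikodym_SigmaFinite.f_integrable.
- exact: emeasurable_funM.
- exact/ae_eqe_mul2l/normal_density.
Qed.

Lemma integrable_normal (f : R -> R) : measurable_fun setT f ->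
  mu.-integrable setT (EFin \o (fun x => f x * pdf x)) ->
  N.-integrable setT (EFin \o f).
Proof.
move=> mf /integrableP[_ fi]; apply/integrableP; split; first exact/measurable_EFinP.
rewrite ge0_integral_normal//; last by apply: measurableT_comp => //; exact/measurable_EFinP.
apply: le_lt_trans fi; rewrite le_eqVlt; apply/orP; left; apply/eqP.
by apply: eq_integral => x _ /=; rewrite -EFinM normrM (ger0_norm (normal_pdf_ge0 _ _ _)).
Qed.

Lemma Rintegral_normal (f : R -> R) : measurable_fun setT f ->
  mu.-integrable setT (EFin \o (fun x => f x * pdf x)) ->
  \int[N]_x f x = \int[mu]_x (f x * pdf x).
Proof.
move=> mf fi; have fN := integrable_normal mf fi.
have dom := normal_prob_dominates m s.
rewrite /Rintegral; congr fine.
rewrite -(Radon_Nikodym_change_of_variables dom)//.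
apply: ae_eq_integral => //.
- by apply: emeasurable_funM => //; exact/measurable_EFinP.
- by apply/measurable_EFinP; apply: measurable_funM => //; exact: measurable_normal_pdf.
- under [X in ae_eq _ _ _ X]eq_fun do rewrite EFinM.
  apply: ae_eqe_mul2l; apply: ae_eq_trans normal_density.
  exact/ae_eq_sym/ae_eq_Radon_Nikodym_SigmaFinite.
Qed.

(* The square root of the unnormalized density: a Gaussian with twice the
   variance. It is integrable, and one factor of it suffices to absorb a
   quadratic polynomial. *)
Let w (x : R) := normal_fun m (Num.sqrt 2 * s) x.

Let s2 : 0 < s ^+ 2. Proof. by rewrite exprn_even_gt0. Qed.

Let wE x : w x = expR (- ((x - m) ^+ 2 / (4 * s ^+ 2))).
Proof.
rewrite /w /normal_fun exprMn sqr_sqrtr//; congr expR.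
by field; rewrite s0.
Qed.

Let pdf_le x : (1 + (x - m) ^+ 2) * pdf x <= normal_peak s * (1 + 4 * s ^+ 2) * w x.
Proof.
have -> : pdf x = normal_peak s * (w x * w x).
  rewrite normal_pdfE// wE -expRD /normal_fun; congr (_ * expR _).
  by field; rewrite s0.
have w0 : 0 < w x by rewrite wE expR_gt0.
have w1 : w x <= 1.
  by rewrite wE -expR0 ler_expR oppr_le0 divr_ge0 ?sqr_ge0// mulr_ge0// ltW.
have yw : (x - m) ^+ 2 * w x <= 4 * s ^+ 2.
  rewrite wE; set u := _ / _; have -> : (x - m) ^+ 2 = 4 * s ^+ 2 * u.
    by rewrite /u; field; rewrite s0.
  have : u * expR (- u) <= 1.
    rewrite expRN ler_pdivrMr ?expR_gt0// mul1r.
    by apply: le_trans (expR_ge1Dx _); rewrite lerDr.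
  by nra.
rewrite mulrCA -mulrA ler_wpM2l ?normal_peak_ge0// mulrA ler_wpM2r ?(ltW w0)//.
by rewrite mulrDl mul1r lerD.
Qed.

Let integrable_w : mu.-integrable setT (EFin \o w).
Proof.
have ss0 : Num.sqrt 2 * s != 0 by rewrite mulf_neq0// gt_eqF// sqrtr_gt0.
have := integrable_normal_pdf m (Num.sqrt 2 * s).
move=> /(@integrableZl _ _ _ mu _ measurableT ((normal_peak (Num.sqrt 2 * s))^-1)).
apply: eq_integrable => // x _ /=.
by rewrite normal_pdfE// -EFinM mulKf// gt_eqF// normal_peak_gt0.
Qed.

Lemma quadratic_normal_integrable (f : R -> R) C : measurable_fun setT f ->
  (forall x, `|f x| <= C * (1 + (x - m) ^+ 2)) ->
  mu.-integrable setT (EFin \o (fun x => f x * pdf x)).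
Proof.
move=> mf fC; pose K := C * (normal_peak s * (1 + 4 * s ^+ 2)).
have C0 : 0 <= C.
  have := fC m; rewrite subrr expr0n addr0 mulr1; exact: le_trans.
have := @integrableZl _ _ _ mu _ measurableT K _ integrable_w.
apply: le_integrable => //.
  by apply/measurable_EFinP; apply: measurable_funM => //; exact: measurable_normal_pdf.
move=> x _ /=; rewrite lee_fin.
apply: (@le_trans _ _ (C * ((1 + (x - m) ^+ 2) * pdf x))).
  by rewrite normrM (ger0_norm (normal_pdf_ge0 _ _ _)) mulrA ler_wpM2r ?normal_pdf_ge0.
apply: le_trans (ler_norm _).
by rewrite /K -mulrA ler_wpM2l.
Qed.

(** Times the density, the integrand is the derivative of
    [s ^+ 2 * f x * pdf x], which vanishes at both infinities. Taking [f = 1] gives the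
    mean, [f x = x - m] the variance, and a sine the cosine transform. *)
Lemma stein_identity (f f' : R -> R) C :
  (forall x : R, is_derive x 1 f (f' x)) -> continuous f' ->
  (forall x, `|f x| <= C * (1 + (x - m) ^+ 2)) ->
  (forall x, `|f' x * s ^+ 2 - (x - m) * f x| <= C * (1 + (x - m) ^+ 2)) ->
  \int[N]_x (f' x * s ^+ 2 - (x - m) * f x) = 0.
Proof.
move=> df cf' fC gC.
set g := fun x => f' x * s ^+ 2 - (x - m) * f x in gC *.
have cf : continuous f.
  by move=> x; apply/differentiable_continuous/derivable1_diffP; case: (df x).
have cg : continuous g.
  move=> x; apply: cvgB; first by apply: cvgM; [exact: cf'|exact: cvg_cst].
  by apply: cvgM; [apply: cvgB; [exact: cvg_id|exact: cvg_cst]|exact: cf].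
have mg : measurable_fun setT g by exact: continuous_measurable_fun.
have ig := quadratic_normal_integrable mg gC.
rewrite Rintegral_normal//.
pose F x := s ^+ 2 * (f x * pdf x).
have dF (x : R) : is_derive x 1 F (g x * pdf x).
  have dp : is_derive x 1 pdf (- (x - m) / s ^+ 2 * pdf x).
    rewrite normal_pdfE//.
    have -> : (fun x => normal_peak s * normal_fun m s x) =
        normal_peak s \*: (expR \o (fun y => - (2 * s ^+ 2)^-1 * (y - m) ^+ 2)).
      apply/funext => y /=; rewrite /normal_fun; congr (_ * expR _).
      by field; rewrite s0.
    have dq : is_derive x 1 (fun y => - (2 * s ^+ 2)^-1 * (y - m) ^+ 2)
        (- (x - m) / s ^+ 2).
      apply: is_derive_eq.
      by rewrite /GRing.scale/=; field; rewrite s0.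
    have de := is_derive1_comp (is_derive_expR _) dq.
    apply: is_derive_eq.
    rewrite /normal_fun.
    have -> : - (x - m) ^+ 2 / (s ^+ 2 *+ 2) = - (2 * s ^+ 2)^-1 * (x - m) ^+ 2.
      by field; rewrite s0.
    by rewrite /GRing.scale/=; field; rewrite s0.
  have dfp := is_deriveM (df x) dp.
  have := is_deriveZ (s ^+ 2) dfp.
  rewrite /F.
  move=> h; apply: is_derive_eq.
  by rewrite /GRing.scale/= /g; field; rewrite s0.
have cF : continuous F.
  by move=> x; apply/differentiable_continuous/derivable1_diffP; case: (dF x).
(* Integrate over [m - k - 1, m + k + 1] and let k tend to infinity. *)
have FTC k : \int[mu]_(x in `[m - k.+1%:R, m + k.+1%:R]) (g x * pdf x)
    = F (m + k.+1%:R) - F (m - k.+1%:R).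
  rewrite /Rintegral (@continuous_FTC2 _ _ F)//.
  - by rewrite ltrD2l (@lt_le_trans _ _ 0)// oppr_lt0.
  - apply: continuous_subspaceT => x; apply: cvgM; first exact: cg.
    exact: continuous_normal_pdf.
  - split => [x _||]; first by case: (dF x).
      by apply: cvg_at_right_filter; exact: cF.
    by apply: cvg_at_left_filter; exact: cF.
  - by move=> x _; rewrite derive1E; exact: derive_val.
have F0 : F (m + k.+1%:R) - F (m - k.+1%:R) @[k --> \oo] --> (0 : R).
  pose K := s ^+ 2 * (C * (normal_peak s * (1 + 4 * s ^+ 2))) * (4 * s ^+ 2).
  have C0 : 0 <= C.
    have := fC m; rewrite subrr expr0n addr0 mulr1; exact: le_trans.
  (* expR (- u) <= u^-1 gives a decay in 1 / k^2, of which 1 / k is enough. *)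
  have Fle k x : (x - m) ^+ 2 = k.+1%:R ^+ 2 -> `|F x| <= K * k.+1%:R^-1.
    move=> xk; rewrite /F normrM (gtr0_norm s2) [leRHS](_ : _ = s ^+ 2 * (C *
      (normal_peak s * (1 + 4 * s ^+ 2) * (4 * s ^+ 2 / k.+1%:R)))); last first.
      by rewrite /K; ring.
    rewrite ler_pM2l//.
    rewrite normrM (ger0_norm (normal_pdf_ge0 _ _ _)).
    apply: (@le_trans _ _ (C * ((1 + (x - m) ^+ 2) * pdf x))).
      by rewrite mulrA ler_wpM2r ?normal_pdf_ge0.
    rewrite ler_wpM2l//; apply: (le_trans (pdf_le x)).
    apply: ler_wpM2l.
      by rewrite mulr_ge0 ?normal_peak_ge0// addr_ge0// mulr_ge0// (ltW s2).
    rewrite wE xk expRN; set u := _ / _.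
    have k2 : 0 < k.+1%:R ^+ 2 :> R by rewrite exprn_gt0.
    have u0 : 0 < u by rewrite divr_gt0// mulr_gt0.
    apply: (@le_trans _ _ u^-1).
      rewrite lef_pV2 ?posrE ?expR_gt0//.
      by apply: le_trans (expR_ge1Dx _); rewrite lerDr.
    rewrite /u invf_div; apply: ler_wpM2l; first by rewrite mulr_ge0// (ltW s2).
    by rewrite lef_pV2 ?posrE// ler_eXnr// ler1n.
  apply: (squeeze_cvgr (f := fun k => - (K * 2 * harmonic k))
     (h := fun k => K * 2 * harmonic k)).
  - apply: nearW => k; rewrite -ler_norml (le_trans (ler_normB _ _))//.
    rewrite mulrAC mulr_natr mulr2n lerD//; apply: Fle.
      by rewrite addrC addKr.
    by rewrite addrAC subrr sub0r sqrrN.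
  - rewrite -oppr0 -(mulr0 (K * 2)); apply: cvgN; apply: cvgM; first exact: cvg_cst.
    exact: cvg_harmonic.
  - rewrite -(mulr0 (K * 2)); apply: cvgM; first exact: cvg_cst.
    exact: cvg_harmonic.
have cvgI : \int[mu]_(x in `[m - k.+1%:R, m + k.+1%:R]) (g x * pdf x) @[k --> \oo]
    --> \int[mu]_x (g x * pdf x).
  pose q x := g x * pdf x.
  have mq : measurable_fun [set: R] q.
    by apply: measurable_funM mg _; exact: measurable_normal_pdf.
  pose A k : set R := `[m - k.+1%:R, m + k.+1%:R]%classic.
  have mA n : measurable_fun [set: R] (q \_ (A n)).
    apply: (measurable_restrictT q (measurable_itv _)).1.
    exact: measurable_funTS.
  have mEA n : measurable_fun [set: R] (EFin \o (q \_ (A n))).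
    exact/measurable_EFinP.
  have mEq : measurable_fun [set: R] (EFin \o q) by exact/measurable_EFinP.
  have [_ _ h] : [/\ mu.-integrable [set: R] (EFin \o q),
    [sequence \int[mu]_x `|(q \_ (A n) x)%:E
                           - (q x)%:E| ]_n @ \oo --> 0%E &
    [sequence \int[mu]_x (q \_ (A n) x)%:E ]_n @ \oo
      --> \int[mu]_x (q x)%:E]%E.
    apply: (@dominated_convergence _ _ _ mu setT measurableT
      (fun n x => (q \_ (A n) x)%:E) _
      (fun x => `|(q x)%:E|)%E) => //.
    - apply: nearW => x _; apply: cvg_near_cst; near=> k.
      rewrite patchE mem_set//; change (x \in `[m - k.+1%:R, m + k.+1%:R]); rewrite in_itv/= -ler_distl.
      near: k; exists (Num.truncn `|x - m|).+1 => // k /= hk.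
      by rewrite (le_trans (ltW (truncnS_gt _)))// ler_nat ltnS ltnW.
    - exact: integrable_abse.
    - apply: nearW => x n _; rewrite patchE; case: ifP => //= _.
      by rewrite normr0 lee_fin.
  have {}h : \int[mu]_x (q \_ (A n)) x @[n --> \oo] --> \int[mu]_x q x.
    by apply: fine_cvg; rewrite fineK//; exact: integrable_fin_num.
  by apply: cvg_trans h; under eq_fun do rewrite Rintegral_mkcond.
rewrite -(cvg_lim (@Rhausdorff R) cvgI) -[RHS](cvg_lim (@Rhausdorff R) F0).
by congr (limn _); apply/funext => k; exact: FTC.
Unshelve. all: by end_near. Qed.

End NormalMoments.

Section NormalCharac.
Context (R : realType) (m s : R).
Hypothesis s0 : s != 0.
Local Notation N := (normal_prob m s).

Let sq_ge0 (x : R) : 0 <= (x - m) ^+ 2. Proof. exact: sqr_ge0. Qed.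

Let lin_le (x : R) : `|x - m| <= 1 + (x - m) ^+ 2.
Proof. by rewrite -real_normK ?num_real//; nra. Qed.

Let mcenter : measurable_fun setT (fun x : R => x - m).
Proof. exact: measurable_funB. Qed.

Lemma integrable_normal_sqr : N.-integrable setT (EFin \o (fun x => (x - m) ^+ 2)).
Proof.
apply: integrable_normal; first exact: measurable_funX.
apply: (@quadratic_normal_integrable _ _ _ s0 _ 1); first exact: measurable_funX.
by move=> x; rewrite mul1r ger0_norm// lerDr.
Qed.

Lemma integrable_normal_center : N.-integrable setT (EFin \o (fun x => x - m)).
Proof.
apply: integrable_normal => //.
by apply: (@quadratic_normal_integrable _ _ _ s0 _ 1) => // x; rewrite mul1r.
Qed.

Lemma normal_prob_mean : \int[N]_x (x - m) = 0.
Proof.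
have h := @stein_identity _ m s s0 (cst 1) (cst 0) 1 (fun=> is_derive_cst _ _ _)
  (fun=> cvg_cst _).
have : \int[N]_x (0 * s ^+ 2 - (x - m) * 1) = 0.
  apply: h => x.
    by rewrite normr1 mul1r lerDl.
  by rewrite mul0r sub0r mulr1 normrN mul1r.
under eq_Rintegral do rewrite mul0r sub0r mulr1 -mulN1r.
rewrite RintegralZl//; last exact: integrable_normal_center.
by move=> e; apply/eqP; rewrite -oppr_eq0 -mulN1r e.
Qed.

Lemma normal_prob_variance : \int[N]_x (x - m) ^+ 2 = s ^+ 2.
Proof.
have s2 : 0 <= s ^+ 2 by exact: sqr_ge0.
have : \int[N]_x (1 * s ^+ 2 - (x - m) * (x - m)) = 0.
  apply: (@stein_identity _ m s s0 (fun x => x - m) (cst 1) (1 + s ^+ 2)).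
  - by move=> x; apply: is_derive_eq; rewrite subr0.
  - by move=> x; exact: cvg_cst.
  - by move=> x; rewrite (le_trans (lin_le x))// ler_peMl ?addr_ge0// lerDl.
  - move=> x; rewrite mul1r -expr2 (le_trans (ler_normB _ _))//.
    rewrite !ger0_norm// mulrDr mulr1 mulrDl mul1r.
    by have := mulr_ge0 s2 (sq_ge0 x); lra.
under eq_Rintegral do rewrite mul1r -expr2.
rewrite RintegralB//; last exact: integrable_normal_sqr.
  by rewrite Rintegral_probability_cst => /eqP; rewrite subr_eq0 => /eqP.
exact: finite_measure_integrable_cst.
Qed.

(** As a function of [t], the left-hand side has derivative
    [- E ((x - m) * sin (t * (x - m) + th))], which Stein's identity turns into
    [- (t * s ^+ 2)] times the function itself. The equation is solved by
    multiplying by [expR (s ^+ 2 * t ^+ 2 / 2)]. *)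
Lemma normal_charac t th :
  \int[N]_x cos (t * (x - m) + th) = cos th * expR (- (s ^+ 2 * t ^+ 2 / 2)).
Proof.
pose phi t := \int[N]_x cos (t * (x - m) + th).
have mlin (u : R) : measurable_fun setT (fun x : R => u * (x - m) + th).
  by apply: measurable_funD => //; apply: measurable_funM.
have dlin (u x : R) : is_derive x 1 (fun x => u * (x - m) + th) u.
  by apply: is_derive_eq; rewrite /GRing.scale/=; ring.
have dlin' (u x : R) : is_derive u 1 (fun u => u * (x - m) + th) (x - m).
  by apply: is_derive_eq; rewrite /GRing.scale/=; ring.
have msin (u : R) : measurable_fun setT (fun x : R => sin (u * (x - m) + th)).
  by apply: measurableT_comp => //; exact: continuous_measurable_fun (@continuous_sin R).
have sin1 (x : R) : `|sin x| <= 1 := norm_sin_le1 x.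
have cos1 (x : R) : `|cos x| <= 1 := norm_cos_le1 x.
have icos u : N.-integrable setT (EFin \o (fun x => cos (u * (x - m) + th))).
  exact: (@integrable_cos_comp _ _ _ N _ (mlin u)).
have ixsin u : N.-integrable setT (EFin \o (fun x => (x - m) * sin (u * (x - m) + th))).
  apply: integrable_normal; first exact: measurable_funM.
  apply: (@quadratic_normal_integrable _ _ _ s0 _ 1); first exact: measurable_funM.
  by move=> x; rewrite mul1r normrM (le_trans _ (lin_le x))// ler_piMr.
have steinE u : \int[N]_x ((x - m) * sin (u * (x - m) + th)) = u * s ^+ 2 * phi u.
  have s2 : 0 <= s ^+ 2 by exact: sqr_ge0.
  have : \int[N]_x (u * cos (u * (x - m) + th) * s ^+ 2
                    - (x - m) * sin (u * (x - m) + th)) = 0.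
    apply: (@stein_identity _ m s s0 (fun x => sin (u * (x - m) + th))
      (fun x => u * cos (u * (x - m) + th)) (1 + `|u| * s ^+ 2)).
    - move=> x; have h := is_derive1_comp (is_derive_sin _) (dlin u x).
      by rewrite mulrC; exact: h.
    - move=> x; apply: cvgM; first exact: cvg_cst.
      apply: (@continuous_comp _ _ _ (fun x => u * (x - m) + th) cos).
        by apply/differentiable_continuous/derivable1_diffP; case: (dlin u x).
      exact: continuous_cos.
    - move=> x; apply: (le_trans (sin1 _)).
      by rewrite mulr_ege1// lerDl// mulr_ge0.
    - move=> x; apply: (le_trans (ler_normB _ _)); rewrite normrM (ger0_norm s2) !normrM.
      have h1 := lin_le x; have h2 := sq_ge0 x.
      have h3 : `|u| * `|cos (u * (x - m) + th)| * s ^+ 2 <= `|u| * s ^+ 2.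
        by rewrite ler_wpM2r// ler_piMr.
      have h4 : `|x - m| * `|sin (u * (x - m) + th)| <= `|x - m| by rewrite ler_piMr.
      have h5 : 0 <= `|u| * s ^+ 2 * (x - m) ^+ 2.
        by apply: mulr_ge0 => //; apply: mulr_ge0.
      set K := `|u| * s ^+ 2 in h3 h5 *; set Y := (x - m) ^+ 2 in h1 h2 h5 *.
      have -> : (1 + K) * (1 + Y) = (K + K * Y) + (1 + Y) by ring.
      apply: lerD; last exact: le_trans h4 h1.
      by apply: (le_trans h3); rewrite lerDl.
  rewrite RintegralB//; last first.
    have := integrableZl measurableT (u * s ^+ 2) (icos u).
    by apply: eq_integrable => // x _ /=; congr (_%:E); ring.
  move=> /eqP; rewrite subr_eq0 => /eqP <-.
  rewrite /phi -RintegralZl//; apply: eq_Rintegral => x _; ring.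
have dphi (u : R) : is_derive u 1 phi (- (u * s ^+ 2 * phi u)).
  have dcos (v x : R) : is_derive v 1 (fun v : R => cos (v * (x - m) + th))
      (- ((x - m) * sin (v * (x - m) + th))).
    have h := is_derive1_comp (is_derive_cos _) (dlin' v x).
    by apply: is_derive_eq h _; rewrite mulrC mulrN.
  have d1E (v x : R) : partial1of2 (fun v x : R => cos (v * (x - m) + th)) v x =
      - ((x - m) * sin (v * (x - m) + th)).
    by rewrite partial1of2E; exact: derive_val.
  have uI : `]u - 1, u + 1[%classic u by rewrite /= in_itv/=; apply/andP; split; lra.
  have derf (v x : R) : `]u - 1, u + 1[%classic v -> [set: R] x ->
      derivable (fun v : R => cos (v * (x - m) + th)) v 1.
    by move=> _ _; case: (dcos v x).
  have ub (v x : R) : `]u - 1, u + 1[%classic v -> [set: R] x ->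
      `|partial1of2 (fun v x : R => cos (v * (x - m) + th)) v x| <= `|x - m|.
    by move=> _ _; rewrite d1E normrN normrM ler_piMr.
  have iG : N.-integrable setT (EFin \o (fun x : R => `|x - m|)).
    exact: integrable_abse integrable_normal_center.
  have icos' (v : R) : `]u - 1, u + 1[%classic v ->
    N.-integrable setT (EFin \o (fun x => cos (v * (x - m) + th))) by move=> _.
  have d := @derivable_under_integral _ _ _ N _ setT measurableT _ _ _ uI
    icos' derf _ (fun=> normr_ge0 _) iG ub.
  have e := @differentiation_under_integral _ _ _ N _ setT measurableT _ _ _ uI
    icos' derf _ (fun=> normr_ge0 _) iG ub.
  apply: DeriveDef => //; rewrite -derive1E [LHS]e -steinE -[RHS]mulN1r -RintegralZl//.
  by apply: eq_Rintegral => x _; rewrite d1E mulN1r.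
(* psi is the constant of integration of phi' u = - u s^2 phi u. *)
pose psi u := phi u * expR (s ^+ 2 * u ^+ 2 / 2).
have dpsi (u : R) : is_derive u 1 psi 0.
  have dq : is_derive u 1 (fun u => s ^+ 2 * u ^+ 2 / 2) (s ^+ 2 * u).
    by apply: is_derive_eq; rewrite /GRing.scale/=; field.
  have de := is_derive1_comp (is_derive_expR _) dq.
  apply: is_derive_eq (is_deriveM (dphi u) de) _.
  by rewrite /GRing.scale/=; ring.
have : psi t = psi 0 by exact: is_derive_0_is_cst.
rewrite /psi expr0n/= mulr0 mul0r expR0 mulr1 => h.
have -> : cos th = phi 0.
  rewrite /phi; under eq_Rintegral do rewrite mul0r add0r.
  by rewrite Rintegral_probability_cst.
by rewrite -h expRN mulfK// gt_eqF// expR_gt0.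
Qed.

End NormalCharac.

(** * Normal random variables *)
Section L2.
Context (R : realType) d (Omega : measurableType d) (P : probability Omega R).

(** Taken on plain functions, so that linear combinations of random variables
    need not be packaged as measurable functions. *)
Definition covr (f g : Omega -> R) : R := fine (covariance P f g).

Lemma sqr_integrable_Lfun2 (f : Omega -> R) : measurable_fun setT f ->
  P.-integrable setT (EFin \o (fun w => f w ^+ 2)) -> f \in Lfun P 2%:E.
Proof.
move=> mf /integrableP[_ fi]; rewrite inE/=; apply/andP; split; rewrite inE//=.
rewrite /finite_norm unlock poweR_lty//.
apply: le_lt_trans fi; rewrite le_eqVlt; apply/orP; left; apply/eqP.
apply: eq_integral => w _ /=.
by rewrite powR_mulrn// normrX.
Qed.

Lemma Lfun2_Lfun1 (f : Omega -> R) : f \in Lfun P 2%:E -> f \in Lfun P 1.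
Proof. by apply: Lfun_subset12; exact: fin_num_measure. Qed.

Lemma Lfun_measurable (f : Omega -> R) p : f \in Lfun P p -> measurable_fun setT f.
Proof. by move=> /andP[]; rewrite inE. Qed.

Lemma expectationR (f : Omega -> R) : f \in Lfun P 1 ->
  'E_P[f]%E = (\int[P]_w f w)%:E.
Proof.
move=> /Lfun1_integrable fi; rewrite unlock /Rintegral fineK//.
exact: integrable_fin_num.
Qed.

End L2.

(** Real-valued random variables take values in the canonical measurable space
    of [R], whereas the normal law lives on the space generated by half-open
    intervals; the sigma-algebras agree but the types do not. *)
Lemma probability_canonical (R : realType) (Q0 : probability (measurableTypeR R) R) :
  exists Q : probability R R, (forall A, Q A = Q0 A) /\
    forall f : R -> \bar R, measurable_fun setT f ->
      (\int[Q]_x f x = \int[Q0]_x f x)%E.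
Proof.
have mid : @measurable_fun _ _ (measurableTypeR R) R setT (fun x => x).
  by move=> _ A mA; rewrite setTI.
pose X : {RV Q0 >-> R} :=
  @mfun_Sub _ _ (measurableTypeR R) R (fun x => x) (mem_set mid).
exists (distribution Q0 X); split=> // f mf.
rewrite integralE [RHS]integralE; congr (_ - _)%E.
  by rewrite ge0_integral_distribution//; exact: measurable_funepos.
by rewrite ge0_integral_distribution//; exact: measurable_funeneg.
Qed.

(** Point masses obey the same formulas with [s = 0]; the probability [Q]
    covers both cases of [normal_law]. *)
Lemma normal_law_moments (R : realType) (m s : R) :
  exists Q : probability R R,
    [/\ forall A, measurable A -> Q A = normal_law m s A,
        Q.-integrable setT (EFin \o (fun x => (x - m) ^+ 2)),
        \int[Q]_x (x - m) = 0, \int[Q]_x (x - m) ^+ 2 = s ^+ 2 &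
        forall t th, \int[Q]_x cos (t * (x - m) + th) =
                     cos th * expR (- (s ^+ 2 * t ^+ 2 / 2))].
Proof.
have [->|s0] := eqVneq s 0; last first.
  have [Q [QE QI]] := probability_canonical (normal_prob m s).
  have mc : measurable_fun setT (fun x : R => x - m) by exact: measurable_funB.
  have msq : measurable_fun setT (fun x : R => (x - m) ^+ 2) by exact: measurable_funX.
  exists Q; split.
  - by move=> A _; rewrite QE /normal_law (negbTE s0).
  - have /integrableP[_ h] := integrable_normal_sqr m s0.
    apply/integrableP; split; first exact/measurable_EFinP.
    by rewrite QI//; apply/measurableT_comp => //; exact/measurable_EFinP.
  - by rewrite -(normal_prob_mean m s0) /Rintegral QI//; exact/measurable_EFinP.
  - by rewrite -(normal_prob_variance m s0) /Rintegral QI//; exact/measurable_EFinP.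
  - move=> t th; rewrite -(normal_charac m s0) /Rintegral QI//.
    apply/measurable_EFinP/measurable_cos_comp.
    by apply: measurable_funD => //; exact: measurable_funM.
pose D : probability R R := @dirac _ R m R.
have DI (f : R -> R) : measurable_fun setT f -> (\int[D]_x (f x)%:E = (f m)%:E)%E.
  move=> mf; rewrite integral_dirac//; last exact/measurable_EFinP.
  by rewrite diracT mul1e.
have dI (f : R -> R) : measurable_fun setT f -> \int[D]_x f x = f m.
  by move=> mf; rewrite /Rintegral DI.
have msq : measurable_fun setT (fun x : R => (x - m) ^+ 2).
  by apply: measurable_funX; exact: measurable_funB.
exists D; split.
- by move=> A _; rewrite /normal_law eqxx.
- apply/integrableP; split; first exact/measurable_EFinP.
  by rewrite /= DI ?ltry//; exact: measurableT_comp.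
- by rewrite dI ?subrr//; exact: measurable_funB.
- by rewrite dI// subrr expr0n.
- move=> t th; rewrite dI ?subrr ?mulr0 ?add0r ?expr0n ?mul0r ?mul0r ?oppr0 ?expR0 ?mulr1//.
  apply: measurable_cos_comp.
  by apply: measurable_funD => //; apply: measurable_funM => //; exact: measurable_funB.
Qed.

Section NormalRV.
Context (R : realType) d (Omega : measurableType d) (P : probability Omega R).

Definition gaussian_charac (Y : Omega -> R) (m v : R) : Prop :=
  forall t th, \int[P]_w cos (t * Y w + th) = cos (t * m + th) * expR (- (v * t ^+ 2 / 2)).

Lemma is_normal_charac (f : Omega -> R) : measurable_fun setT f ->
  is_normal P f -> f \in Lfun P 2%:E /\
  gaussian_charac f (\int[P]_w f w) (covr P f f).
Proof.
move=> mf; pose Y : {RV P >-> R} := mfun_Sub (mem_set mf).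
rewrite -[f]/(Y : Omega -> R); move: Y => {f mf} Y.
move=> [m [s [s0 YE]]]; have [Q [QE Q2 Qm Qv Qc]] := normal_law_moments m s.
have dYQ A : measurable A -> distribution P Y A = Q A.
  by move=> mA; apply: etrans (YE _ mA) _; exact/esym/QE.
have tr (f : R -> R) : measurable_fun setT f ->
    P.-integrable setT (EFin \o (fun w => f (Y w))) ->
    \int[P]_w f (Y w) = \int[Q]_x f x.
  move=> mf fi; rewrite /Rintegral; congr fine.
  rewrite -(@integral_distribution _ _ _ _ _ P Y (EFin \o f))//; last exact/measurable_EFinP.
  by apply: eq_measure_integral => A mA _; exact: dYQ.
have mYm : measurable_fun setT (fun w => Y w - m) by exact: measurable_funB.
have msq : measurable_fun setT (fun x : R => (x - m) ^+ 2).
  by apply: measurable_funX; exact: measurable_funB.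
have Ym2 : (fun w => Y w - m) \in Lfun P 2%:E.
  apply: sqr_integrable_Lfun2 => //.
  case/integrableP: Q2 => _ Q2; apply/integrableP; split.
    exact/measurable_EFinP/measurable_funX.
  rewrite -(@ge0_integral_distribution _ _ _ _ _ P Y
    (fun x => `|((x - m) ^+ 2)%:E|%E))//; last exact/measurableT_comp/measurable_EFinP.
  rewrite (_ : (\int[_]_x _)%E = (\int[Q]_x `|((x - m) ^+ 2)%:E|)%E)//.
  by apply: eq_measure_integral => A mA _; exact: dYQ.
have Y2 : (Y : Omega -> R) \in Lfun P 2%:E.
  rewrite (_ : (Y : Omega -> R) = (fun w => Y w - m) \+ cst m).
    by rewrite rpredD ?lee1n//= Lfun_cst.
  by apply/funext => w /=; rewrite subrK.
have iY : P.-integrable setT (EFin \o (Y : Omega -> R)).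
  exact/Lfun1_integrable/Lfun2_Lfun1.
have EY : \int[P]_w Y w = m.
  apply/eqP; rewrite -subr_eq0 -(Rintegral_probability_cst P m).
  rewrite -RintegralB//; last exact: finite_measure_integrable_cst.
  by rewrite (tr (fun x => x - m)) ?Qm//; [exact: measurable_funB|
    exact/Lfun1_integrable/Lfun2_Lfun1].
have VY : covr P Y Y = s ^+ 2.
  have EE : 'E_P[Y]%E = m%:E by rewrite expectationR ?EY//; exact: Lfun2_Lfun1.
  rewrite /covr unlock EE/= unlock -Qv -(tr (fun x => (x - m) ^+ 2))//.
  exact: Lfun2_integrable_sqr Ym2.
split=> // t th; rewrite EY VY -Qc.
rewrite -(tr (fun x => cos (t * (x - m) + (t * m + th)))).
- by apply: eq_Rintegral => w _; congr cos; ring.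
- apply: measurable_cos_comp.
  by apply: measurable_funD => //; apply: measurable_funM => //; exact: measurable_funB.
- apply: integrable_cos_comp.
  by apply: measurable_funD => //; exact: measurable_funM.
Qed.

(** The cosine transform is that of a normal law, and [charac_unique] in
    dimension one identifies the two laws. *)
Lemma charac_is_normal (f : Omega -> R) m v : measurable_fun setT f ->
  0 <= v -> gaussian_charac f m v -> is_normal P f.
Proof.
move=> mf; pose Y : {RV P >-> R} := mfun_Sub (mem_set mf).
rewrite -[f]/(Y : Omega -> R); move: Y => {f mf} Y v0 Yc; exists m, (Num.sqrt v); split; first exact: sqrtr_ge0.
move=> A mA; have [Q [QE _ _ _ Qc]] := normal_law_moments m (Num.sqrt v).
rewrite -QE//.
have mid : @measurable_fun _ _ R R setT (fun x => x) by exact: measurable_id.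
pose X : {RV Q >-> R} := @mfun_Sub _ _ R R (fun x => x) (mem_set mid).
have mA1 : measurable [set y : 1.-tuple R | A (tnth y ord0)].
  by rewrite -[X in measurable X]setTI; exact: measurable_tnth.
have := @charac_unique _ 1 _ _ P _ _ Q (fun=> Y) (fun=> X) _ _ mA1.
have E d0 (T : measurableType d0) (V : T -> R) :
    [set w | [set y : 1.-tuple R | A (tnth y ord0)] [tuple V w | i < 1]] = V @^-1` A.
  by apply/seteqP; split=> w /=; rewrite tnth_mktuple.
rewrite !E; apply => c th.
under eq_Rintegral do rewrite big_ord1.
under [RHS]eq_Rintegral do rewrite big_ord1.
rewrite Yc -(sqr_sqrtr v0) -Qc; apply: eq_Rintegral => x _; congr cos.
by rewrite /X/=; ring.
Qed.

End NormalRV.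

(** * Square integrable variables and mean-square convergence *)
Lemma cvg_sqr0 (R : realType) (I : Type) (F : set_system I) (FF : Filter F)
  (u : I -> R) : u i ^+ 2 @[i --> F] --> (0 : R) -> u i @[i --> F] --> (0 : R).
Proof.
move=> /cvgrPdist_lt h; apply/cvgrPdist_lt => e e0.
have := h (e ^+ 2); rewrite exprn_gt0// => /(_ isT); apply: filterS => i.
rewrite !sub0r !normrN ger0_norm ?sqr_ge0// -real_normK ?num_real//.
by rewrite ltr_pXn2r ?nnegrE// ltW.
Qed.

Section CovR.
Context (R : realType) d (Omega : measurableType d) (P : probability Omega R).
Implicit Types f g h : Omega -> R.
Local Notation L2 f := (f \in Lfun P 2%:E).

Lemma L2D f g : L2 f -> L2 g -> L2 (fun w => f w + g w).
Proof. by move=> f2 g2; rewrite -[X in X \in _]/(f \+ g) rpredD ?lee1n. Qed.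

Lemma L2Z k f : L2 f -> L2 (fun w => k * f w).
Proof.
move=> f2; rewrite (_ : (fun w => k * f w) = k \o* f) ?Lfun_scale ?ler1n//.
by apply/funext => w /=; rewrite mulrC.
Qed.

Lemma L2B f g : L2 f -> L2 g -> L2 (fun w => f w - g w).
Proof.
move=> f2 g2; rewrite (_ : (fun w => f w - g w) = fun w => f w + -1 * g w).
  exact: L2D (L2Z (-1) g2).
by apply/funext => w /=; rewrite mulN1r.
Qed.

Lemma L2cst k : L2 (fun=> k). Proof. exact: Lfun_cst. Qed.

Lemma L2sum (I : Type) (r : seq I) (F : I -> Omega -> R) :
  (forall i, L2 (F i)) -> L2 (fun w => \sum_(i <- r) F i w).
Proof.
move=> F2; elim: r => [|i r IH].
  by under eq_fun do rewrite big_nil; exact: L2cst.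
by under eq_fun do rewrite big_cons; exact: L2D.
Qed.

Lemma L2_integrable f : L2 f -> P.-integrable setT (EFin \o f).
Proof. by move=> /Lfun2_Lfun1/Lfun1_integrable. Qed.

Lemma RV_integrableZ k f : P.-integrable setT (EFin \o f) ->
  P.-integrable setT (EFin \o (fun w => k * f w)).
Proof. by move=> fi; exact: (integrableZl measurableT k fi). Qed.

Lemma RV_integrableD f g : P.-integrable setT (EFin \o f) ->
  P.-integrable setT (EFin \o g) -> P.-integrable setT (EFin \o (fun w => f w + g w)).
Proof. by move=> fi gi; exact: (integrableD measurableT fi gi). Qed.

Lemma covarianceR f g : L2 f -> L2 g -> covariance P f g = (covr P f g)%:E.
Proof.
move=> f2 g2; rewrite /covr fineK//.
have [[f1 g1] fg] := (Lfun2_Lfun1 f2, Lfun2_Lfun1 g2, Lfun2_mul_Lfun1 f2 g2).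
exact: covariance_fin_num.
Qed.

Lemma covrE f g : L2 f -> L2 g ->
  covr P f g = \int[P]_w (f w * g w) - \int[P]_w f w * \int[P]_w g w.
Proof.
move=> f2 g2.
have [[f1 g1] fg] := (Lfun2_Lfun1 f2, Lfun2_Lfun1 g2, Lfun2_mul_Lfun1 f2 g2).
by rewrite /covr covarianceE// !expectationR.
Qed.

Lemma covrC f g : covr P f g = covr P g f.
Proof. by rewrite /covr covarianceC. Qed.

Lemma covrDl f g h : L2 f -> L2 g -> L2 h ->
  covr P (fun w => f w + g w) h = covr P f h + covr P g h.
Proof.
move=> f2 g2 h2; apply: EFin_inj; rewrite EFinD -!covarianceR//; last exact: L2D.
exact: covarianceDl.
Qed.

Lemma covrZl k f h : L2 f -> L2 h -> covr P (fun w => k * f w) h = k * covr P f h.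
Proof.
move=> f2 h2; apply: EFin_inj; rewrite EFinM -!covarianceR//; last exact: L2Z.
have [[f1 h1] fh] := (Lfun2_Lfun1 f2, Lfun2_Lfun1 h2, Lfun2_mul_Lfun1 f2 h2).
rewrite -covarianceZl//.
by congr covariance; apply/funext => w /=; rewrite mulrC.
Qed.

Lemma covr_cstl k h : covr P (fun=> k) h = 0.
Proof. by rewrite /covr covariance_cst_l. Qed.

Lemma covrDr f g h : L2 f -> L2 g -> L2 h ->
  covr P h (fun w => f w + g w) = covr P h f + covr P h g.
Proof. by move=> f2 g2 h2; rewrite covrC covrDl// !(covrC h). Qed.

Lemma covrZr k f h : L2 f -> L2 h -> covr P h (fun w => k * f w) = k * covr P h f.
Proof. by move=> f2 h2; rewrite covrC covrZl// covrC. Qed.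

Lemma covrBl f g h : L2 f -> L2 g -> L2 h ->
  covr P (fun w => f w - g w) h = covr P f h - covr P g h.
Proof.
move=> f2 g2 h2; rewrite -mulN1r -covrZl// -covrDl//; last exact: L2Z.
by congr covr; apply/funext => w; rewrite mulN1r.
Qed.

Lemma covrBr f g h : L2 f -> L2 g -> L2 h ->
  covr P h (fun w => f w - g w) = covr P h f - covr P h g.
Proof. by move=> f2 g2 h2; rewrite covrC covrBl// !(covrC h). Qed.

Lemma covr_suml (I : Type) (r : seq I) (F : I -> Omega -> R) h :
  (forall i, L2 (F i)) -> L2 h ->
  covr P (fun w => \sum_(i <- r) F i w) h = \sum_(i <- r) covr P (F i) h.
Proof.
move=> F2 h2; elim: r => [|i r IH].
  by under eq_fun do rewrite big_nil; rewrite covr_cstl big_nil.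
under eq_fun do rewrite big_cons.
by rewrite covrDl// ?IH ?big_cons//; exact: L2sum.
Qed.

Lemma covr_ge0 f : 0 <= covr P f f.
Proof. by rewrite /covr fine_ge0//; exact: variance_ge0. Qed.

(** The upper bound on the covariance, applied to [f] and to [- f], bounds its
    absolute value. *)
Lemma cauchy_schwarz_covr f g : L2 f -> L2 g ->
  covr P f g ^+ 2 <= covr P f f * covr P g g.
Proof.
move=> f2 g2.
have le f' : L2 f' -> covr P f' g <= Num.sqrt (covr P f' f') * Num.sqrt (covr P g g).
  move=> f'2; rewrite -lee_fin EFinM -covarianceR//.
  apply: le_trans (covariance_le f'2 g2) _.
  by rewrite /variance !covarianceR.
have h1 := le _ f2; have := le _ (L2Z (-1) f2).
rewrite !(covrZl, covrZr)//; [|exact: L2Z..].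
rewrite !mulN1r opprK => h2.
rewrite -[leRHS]sqr_sqrtr ?mulr_ge0 ?covr_ge0// sqrtrM ?covr_ge0//.
by rewrite -subr_ge0 subr_sqr mulr_ge0//; lra.
Qed.

Lemma mean_covr_sqr f : L2 f ->
  \int[P]_w f w ^+ 2 = covr P f f + (\int[P]_w f w) ^+ 2.
Proof.
move=> f2; rewrite covrE//; under [in RHS]eq_Rintegral do rewrite -expr2.
by rewrite -expr2 subrK.
Qed.

Lemma covr_lin n (c : 'I_n -> R) (V : 'I_n -> Omega -> R) :
  (forall i, V i \in Lfun P 2%:E) ->
  covr P (fun w => \sum_i c i * V i w) (fun w => \sum_i c i * V i w) =
  \sum_i \sum_j c i * c j * covr P (V i) (V j).
Proof.
move=> V2; have cV2 i := L2Z (c i) (V2 i).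
rewrite covr_suml//; last exact: L2sum.
apply: eq_bigr => i _; rewrite covrC covr_suml//; apply: eq_bigr => j _.
by rewrite covrZl// covrZr// covrC; ring.
Qed.

Lemma Rintegral_sum_L2 (I : Type) (r : seq I) (F : I -> Omega -> R) :
  (forall i, F i \in Lfun P 2%:E) ->
  \int[P]_w (\sum_(i <- r) F i w) = \sum_(i <- r) \int[P]_w F i w.
Proof.
move=> F2; elim: r => [|i r IH].
  by under eq_Rintegral do rewrite big_nil; rewrite Rintegral_probability_cst big_nil.
under eq_Rintegral do rewrite big_cons.
rewrite RintegralD ?IH ?big_cons//; first exact: L2_integrable.
exact/L2_integrable/L2sum.
Qed.

End CovR.

Section MeanSquare.
Context (R : realType) d (Omega : measurableType d) (P : probability Omega R).
Context (I : Type) (F : set_system I) {FF : Filter F}.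
Implicit Types (S : I -> Omega -> R) (Y f g : Omega -> R).
Local Notation L2 f := (f \in Lfun P 2%:E).

Definition ms_cvg S Y : Prop :=
  [/\ forall i, L2 (S i), L2 Y &
      \int[P]_w (S i w - Y w) ^+ 2 @[i --> F] --> (0 : R)].

Lemma ms_cvg_cst Y : L2 Y -> ms_cvg (fun=> Y) Y.
Proof.
move=> Y2; split=> //; under eq_fun => i.
  under eq_Rintegral do rewrite subrr expr0n.
  by rewrite Rintegral_probability_cst; over.
exact: cvg_cst.
Qed.

Lemma ms_cvgZ k S Y : ms_cvg S Y ->
  ms_cvg (fun i w => k * S i w) (fun w => k * Y w).
Proof.
move=> [S2 Y2 SY]; split=> [i||]; [exact: L2Z..|].
rewrite -(mulr0 (k ^+ 2)).
under eq_fun => i.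
  under eq_Rintegral do rewrite -mulrBr exprMn.
  rewrite RintegralZl//; last exact/Lfun2_integrable_sqr/L2B.
  over.
by apply: cvgM => //; exact: cvg_cst.
Qed.

Lemma ms_cvgD S Y S' Y' : ms_cvg S Y -> ms_cvg S' Y' ->
  ms_cvg (fun i w => S i w + S' i w) (fun w => Y w + Y' w).
Proof.
move=> [S2 Y2 SY] [S'2 Y'2 SY']; split=> [i||]; [exact: L2D..|].
apply: (squeeze_cvgr (f := fun=> 0) (h := fun i =>
  2 * \int[P]_w (S i w - Y w) ^+ 2 + 2 * \int[P]_w (S' i w - Y' w) ^+ 2)).
- apply: nearW => i; apply/andP; split.
    by apply: Rintegral_ge0 => w _; exact: sqr_ge0.
  have i1 := Lfun2_integrable_sqr (L2B (S2 i) Y2).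
  have i2 := Lfun2_integrable_sqr (L2B (S'2 i) Y'2).
  rewrite -!RintegralZl// -RintegralD//; [|exact: RV_integrableZ..].
  apply: le_Rintegral => //.
  - exact: Lfun2_integrable_sqr (L2B (L2D (S2 i) (S'2 i)) (L2D Y2 Y'2)).
  - by apply: RV_integrableD; exact: RV_integrableZ.
  - move=> w _; rewrite opprD addrACA.
    set a := S i w - Y w; set b := S' i w - Y' w.
    have -> : 2 * a ^+ 2 + 2 * b ^+ 2 = (a + b) ^+ 2 + (a - b) ^+ 2 by ring.
    by rewrite lerDl sqr_ge0.
- exact: cvg_cst.
- by rewrite -[X in _ --> X](addr0 0); apply: cvgD;
    rewrite -(mulr0 2); apply: cvgM => //; exact: cvg_cst.
Qed.

Lemma ms_cvg_sum (J : Type) (r : seq J) (S : J -> I -> Omega -> R)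
    (Y : J -> Omega -> R) : (forall j, ms_cvg (S j) (Y j)) ->
  ms_cvg (fun i w => \sum_(j <- r) S j i w) (fun w => \sum_(j <- r) Y j w).
Proof.
move=> SY; elim: r => [|j r IH].
  have := ms_cvg_cst (L2cst P 0); congr ms_cvg.
    by apply/funext => i; apply/funext => w; rewrite big_nil.
  by apply/funext => w; rewrite big_nil.
have := ms_cvgD (SY j) IH; congr ms_cvg.
  by apply/funext => i; apply/funext => w; rewrite big_cons.
by apply/funext => w; rewrite big_cons.
Qed.

Lemma ms_cvg_var0 S Y : ms_cvg S Y ->
  covr P (fun w => S i w - Y w) (fun w => S i w - Y w) @[i --> F] --> (0 : R).
Proof.
move=> [S2 Y2 SY]; apply: (squeeze_cvgr (f := fun=> 0) _ _ SY); last exact: cvg_cst.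
apply: nearW => i; rewrite covr_ge0/= mean_covr_sqr ?lerDl ?sqr_ge0//.
exact: L2B.
Qed.

(** The square of a mean is at most the second moment. *)
Lemma ms_cvg_mean S Y : ms_cvg S Y ->
  \int[P]_w S i w @[i --> F] --> \int[P]_w Y w.
Proof.
move=> [S2 Y2 SY]; apply/subr_cvg0.
have sq : (\int[P]_w S i w - \int[P]_w Y w) ^+ 2 @[i --> F] --> (0 : R).
  apply: (squeeze_cvgr (f := fun=> 0) _ _ SY); last exact: cvg_cst.
  apply: nearW => i; rewrite sqr_ge0/= mean_covr_sqr; last exact: L2B.
  by rewrite RintegralB ?lerDr ?covr_ge0//; exact: L2_integrable.
exact: cvg_sqr0 sq.
Qed.

Lemma ms_cvg_covr S Y f : L2 f -> ms_cvg S Y ->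
  covr P (S i) f @[i --> F] --> covr P Y f.
Proof.
move=> f2 SY; have [S2 Y2 _] := SY.
apply/subr_cvg0.
have sq : (covr P (S i) f - covr P Y f) ^+ 2 @[i --> F] --> (0 : R).
  have h := ms_cvg_var0 SY.
  apply: (squeeze_cvgr (f := fun=> 0) (h := fun i =>
    covr P (fun w => S i w - Y w) (fun w => S i w - Y w) * covr P f f)).
  - apply: nearW => i; rewrite sqr_ge0/= -covrBl//.
    by apply: cauchy_schwarz_covr => //; exact: L2B.
  - exact: cvg_cst.
  - by rewrite -(mul0r (covr P f f)); apply: cvgM => //; exact: cvg_cst.
exact: cvg_sqr0 sq.
Qed.

Lemma ms_cvg_var S Y : ms_cvg S Y ->
  covr P (S i) (S i) @[i --> F] --> covr P Y Y.
Proof.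
move=> SY; have [S2 Y2 _] := SY.
have -> : (fun i => covr P (S i) (S i)) = (fun i =>
    covr P (fun w => S i w - Y w) (fun w => S i w - Y w)
    + covr P (S i) Y + covr P (S i) Y - covr P Y Y).
  apply/funext => i; rewrite covrBl ?covrBr//; last exact: L2B.
  by rewrite (covrC _ Y (S i)); ring.
have e : 0 + covr P Y Y + covr P Y Y - covr P Y Y = covr P Y Y by ring.
rewrite -[X in _ --> X]e.
apply: cvgB; last exact: cvg_cst.
apply: cvgD; last exact: ms_cvg_covr.
by apply: cvgD; [exact: ms_cvg_var0|exact: ms_cvg_covr].
Qed.

End MeanSquare.

Lemma ms_cvg_comp (R : realType) d (Omega : measurableType d) (P : probability Omega R)
    (I J : Type) (F : set_system I) (G : set_system J) (v : J -> I)
    (S : I -> Omega -> R) (Y : Omega -> R) :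
  v @ G --> F -> ms_cvg P F S Y -> ms_cvg P G (fun j => S (v j)) Y.
Proof.
move=> vF [S2 Y2 SY]; split=> //.
exact: (cvg_comp v (fun i => \int[P]_w (S i w - Y w) ^+ 2) vF SY).
Qed.

(** * Mean-square limits of normal variables *)
Lemma cos_lipschitz (R : realType) (x y : R) : (cos x - cos y) ^+ 2 <= (x - y) ^+ 2.
Proof.
wlog xy : x y / y <= x => [h|].
  have [/h//|/ltW/h] := leP y x.
  by rewrite -sqrrN opprB => /le_trans; apply; rewrite -sqrrN opprB.
have [c _ ->] := @MVT_segment R cos (fun z => - sin z) y x xy
  (fun z _ => is_derive_cos z) (continuous_subspaceT (@continuous_cos R)).
rewrite exprMn sqrrN ler_piMl ?sqr_ge0//.
Qed.

Section GaussianLimit.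
Context (R : realType) d (Omega : measurableType d) (P : probability Omega R).

Lemma bounded_L2 (f : Omega -> R) M : measurable_fun setT f ->
  (forall w, `|f w| <= M) -> f \in Lfun P 2%:E.
Proof.
move=> mf fM; apply: sqr_integrable_Lfun2 => //.
apply: (@bounded_integrable _ _ _ _ _ (M ^+ 2)); first exact: measurable_funX.
move=> w; rewrite normrX ler_pXn2r ?nnegrE//.
by apply: le_trans (fM w).
Qed.

(** By [cos_lipschitz], the cosine transforms of [S n] converge to that of [Y];
    so do their means and variances, hence the transform of [Y] has the normal
    form. *)
Lemma ms_limit_normal (S : nat -> Omega -> R) (Y : Omega -> R) :
  ms_cvg P \oo S Y -> (forall n, is_normal P (S n)) -> is_normal P Y.
Proof.
move=> SY Sn; have [S2 Y2 SY2] := SY.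
have mcos f t th : f \in Lfun P 2%:E -> measurable_fun setT (fun w => cos (t * f w + th)).
  move=> /Lfun_measurable mf; apply: measurable_cos_comp.
  by apply: measurable_funD => //; exact: measurable_funM.
have cos2 f t th : f \in Lfun P 2%:E -> (fun w => cos (t * f w + th)) \in Lfun P 2%:E.
  by move=> f2; apply: (bounded_L2 (M := 1)); [exact: mcos|move=> w; exact: norm_cos_le1].
apply: (charac_is_normal (m := \int[P]_w Y w) (v := covr P Y Y)).
- exact: Lfun_measurable Y2.
- exact: covr_ge0.
move=> t th.
have c1 : \int[P]_w cos (t * S n w + th) @[n --> \oo] --> \int[P]_w cos (t * Y w + th).
  apply/subr_cvg0; suff sq : (\int[P]_w cos (t * S n w + th)
      - \int[P]_w cos (t * Y w + th)) ^+ 2 @[n --> \oo] --> (0 : R).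
    exact: cvg_sqr0 sq.
  apply: (squeeze_cvgr (f := fun=> 0) (h := fun n => t ^+ 2 * \int[P]_w (S n w - Y w) ^+ 2)).
  - apply: nearW => n; rewrite sqr_ge0/=.
    have d2 := L2B (cos2 _ t th (S2 n)) (cos2 _ t th Y2).
    rewrite -RintegralB//; [|exact: L2_integrable (cos2 _ _ _ _)..].
    apply: (@le_trans _ _ (\int[P]_w (cos (t * S n w + th) - cos (t * Y w + th)) ^+ 2)).
      by rewrite (mean_covr_sqr d2) lerDr covr_ge0.
    have i2 := Lfun2_integrable_sqr (L2B (S2 n) Y2).
    rewrite -RintegralZl//; apply: le_Rintegral => //.
    + exact: Lfun2_integrable_sqr d2.
    + exact: RV_integrableZ.
    + move=> w _; apply: (le_trans (cos_lipschitz _ _)).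
      by rewrite -exprMn le_eqVlt; apply/orP; left; apply/eqP; ring.
  - exact: cvg_cst.
  - by rewrite -(mulr0 (t ^+ 2)); apply: cvgM => //; exact: cvg_cst.
have c2 : cos (t * \int[P]_w S n w + th) * expR (- (covr P (S n) (S n) * t ^+ 2 / 2)) @[n --> \oo]
    --> cos (t * \int[P]_w Y w + th) * expR (- (covr P Y Y * t ^+ 2 / 2)).
  apply: cvgM.
    apply: continuous_cvg; first exact: continuous_cos.
    apply: cvgD; last exact: cvg_cst.
    by apply: cvgM; [exact: cvg_cst|exact: ms_cvg_mean].
  apply: continuous_cvg; first exact: continuous_expR.
  apply: cvgN; apply: cvgM; last exact: cvg_cst.
  by apply: cvgM; [exact: ms_cvg_var|exact: cvg_cst].
rewrite -(cvg_lim (@Rhausdorff R) c1) -(cvg_lim (@Rhausdorff R) c2).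
congr (limn _); apply/funext => n.
have [_ ->] := is_normal_charac (Lfun_measurable (S2 n)) (Sn n).
by [].
Qed.

End GaussianLimit.

(** * Derivatives within a compact interval *)
Section DerivativeOnInterval.
Context (R : realType) (a b : R).
Local Notation T := (`[a, b]%classic : set R).

Lemma has_deriv_onB (f g : R -> R) t l l' :
  has_deriv_on T f t l -> has_deriv_on T g t l' ->
  has_deriv_on T (fun s => f s - g s) t (l - l').
Proof.
move=> fl gl; rewrite /has_deriv_on; under eq_fun do
  rewrite opprD addrACA -opprD mulrBl.
exact: cvgB.
Qed.

Lemma has_deriv_on_cont (f : R -> R) t l : T t -> has_deriv_on T f t l ->
  f s @[s --> within T (nbhs t)] --> f t.
Proof.
move=> Tt fl; apply/subr_cvg0.
have h : (f s - f t) / (s - t) * (s - t) @[s --> within T t^'] --> l * 0.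
  apply: cvgM => //; apply/subr_cvg0; apply: cvg_trans (@cvg_id _ (nbhs t)).
  by apply: cvg_within_filter; apply: cvg_within.
rewrite mulr0 in h; apply/cvgrPdist_lt => e e0.
move/cvgrPdist_lt: h => /(_ e e0) h.
have {}h : \forall s \near nbhs t, s != t -> T s ->
  `|0 - (f s - f t) / (s - t) * (s - t)| < e := h.
suff : \forall s \near nbhs t, T s -> `|0 - (f s - f t)| < e by [].
apply: filterS h => s hs Ts.
have [->|st] := eqVneq s t; first by rewrite subrr subr0 normr0.
by have := hs st Ts; rewrite divfK// subr_eq0.
Qed.

(** Caratheodory's criterion: the difference quotient, completed by [l] at [t],
    is continuous at [t]. *)
Lemma has_deriv_on_is_derive (f : R -> R) t l : t \in `]a, b[ ->
  has_deriv_on T f t l -> is_derive t 1 f l.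
Proof.
move=> tab fl; apply/is_derive1_caratheodory.
exists (fun z => if z == t then l else (f z - f t) / (z - t)); split.
- move=> z; case: eqVneq => [->|zt]; first by rewrite !subrr mulr0.
  by rewrite divfK// subr_eq0.
- apply/continuous_withinNx.
  apply/cvgrPdist_lt => e e0.
  move/cvgrPdist_lt: fl => /(_ e e0) h.
  have {}h : \forall z \near nbhs t, z != t -> T z ->
    `|l - (f z - f t) / (z - t)| < e := h.
  suff : \forall z \near nbhs t, z != t ->
    `|(if t == t then l else (f t - f t) / (t - t))
      - (if z == t then l else (f z - f t) / (z - t))| < e by [].
  rewrite eqxx; apply: filterS2 (near_in_itvoo tab) h => z zab hz zt.
  by rewrite (negbTE zt); apply: hz => //; exact: subset_itv_oo_cc zab.
- by rewrite eqxx.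
Qed.

(** The mean value theorem for either order of [u] and [v]; the bound on [c - u]
    keeps [c] in every neighbourhood of [u] that contains [v]. *)
Lemma MVT_on (f f' : R -> R) u v :
  (forall x, T x -> has_deriv_on T f x (f' x)) -> T u -> T v -> u != v ->
  exists c, [/\ T c, `|c - u| <= `|v - u| & f v - f u = f' c * (v - u)].
Proof.
move=> df.
have main x y : x < y -> T x -> T y ->
    exists2 c, c \in `]x, y[ & f y - f x = f' c * (y - x).
  move=> xy Tx Ty.
  have sub z : z \in `[x, y] -> T z.
    move: Tx Ty; rewrite /= !in_itv/= => /andP[ax _] /andP[_ yb] /andP[xz zy].
    by rewrite (le_trans ax xz) (le_trans zy yb).
  apply: MVT => //.
  - move=> z zxy; apply: has_deriv_on_is_derive (df z _).
      move: Tx Ty zxy; rewrite /= !in_itv/= => /andP[ax _] /andP[_ yb] /andP[xz zy].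
      by rewrite (le_lt_trans ax xz) (lt_le_trans zy yb).
    by apply: sub; exact: subset_itv_oo_cc zxy.
  - apply/subspace_continuousP => z zxy.
    have h := has_deriv_on_cont (sub _ zxy) (df _ (sub _ zxy)).
    by apply: cvg_trans h; apply: cvg_fmap2; apply: within_subset => // w; exact: sub.
move=> Tu Tv; rewrite neq_lt => /orP[uv|vu].
- have [c + e] := main _ _ uv Tu Tv; rewrite in_itv/= => /andP[uc cv]; exists c; split => //.
    move: Tu Tv; rewrite /= !in_itv/= => /andP[ax _] /andP[_ yb].
    by rewrite (le_trans ax (ltW uc)) (le_trans (ltW cv) yb).
  by rewrite !ger0_norm ?subr_ge0 ?lerD2r// ltW.
- have [c + e] := main _ _ vu Tv Tu; rewrite in_itv/= => /andP[vc cu]; exists c; split => //.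
  + move: Tu Tv; rewrite /= !in_itv/= => /andP[_ ub] /andP[av _].
    by rewrite (le_trans av (ltW vc)) (le_trans (ltW cu) ub).
  + by rewrite !ler0_norm ?subr_le0 ?lerN2 ?lerD2r// ltW.
  + by rewrite -[LHS]opprB e -mulrN opprB.
Qed.

End DerivativeOnInterval.

(** Caratheodory's factorization [ln y - ln y0 = g y * (y - y0)] gives the chain
    rule without dividing by [f s - f t], which may vanish for [s] near [t]. *)
Lemma has_deriv_on_ln (R : realType) (a b : R) (f : R -> R) t l :
  `[a, b]%classic t -> 0 < f t -> has_deriv_on `[a, b]%classic f t l ->
  has_deriv_on `[a, b]%classic (fun s => ln (f s)) t (l / f t).
Proof.
move=> Tt ft0 fl.
have /is_derive1_caratheodory[g [gE gc gft]] := is_derive1_ln ft0.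
rewrite /has_deriv_on; under eq_fun do rewrite gE -mulrA mulrC.
apply: cvgM => //; rewrite -gft.
apply: (cvg_comp _ g); last exact: gc.
apply: cvg_trans (has_deriv_on_cont Tt fl).
apply: cvg_fmap2.
move=> A; rewrite /within/= => h.
have {}h : \forall s \near nbhs t, `[a, b]%classic s -> A s := h.
suff : \forall s \near nbhs t, s != t -> `[a, b]%classic s -> A s by [].
by apply: filterS h => s h _; exact: h.
Qed.

(** * Differentiability in mean square *)
Section MeanSquareDerivative.
Context (R : realType) (a b : R) d (Omega : measurableType d) (P : probability Omega R).
Local Notation T := (`[a, b]%classic : set R).

(** Two applications of the mean value theorem, one in each variable, make the
    mixed quotient a value of the mixed derivative near [(t, t)]; the limit is
    the mixed derivative at that point. *)
Lemma mixed_quotient_cvg (G : R -> R -> R) t : T t -> smooth_kernel T G ->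
  exists l, forall e, 0 < e -> exists2 r, 0 < r & forall s s', T s -> T s' ->
    s != t -> s' != t -> `|s - t| < r -> `|s' - t| < r ->
    `|(G s s' - G s t - G t s' + G t t) / ((s - t) * (s' - t)) - l| <= e.
Proof.
move=> Tt [G10 [G01 [G11 [dG _ _ _ cG11]]]]; exists (G11 t t) => e e0.
have [r r0 hr] : exists2 r, 0 < r & forall x y, T x -> T y ->
    `|x - t| < r -> `|y - t| < r -> `|G11 x y - G11 t t| < e.
  move/subspace_continuousP: cG11 => /(_ (t, t) (conj Tt Tt)).
  move=> /cvgrPdist_lt/(_ e e0) [[A B] [/= /nbhs_ballP[r1 /= r10 h1]
    /nbhs_ballP[r2 /= r20 h2]] h].
  exists (Num.min r1 r2); first by rewrite lt_min r10.
  move=> x y Tx Ty; rewrite !lt_min => /andP[xr _] /andP[_ yr].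
  rewrite distrC; apply: (h (x, y)); last by split.
  by split; [apply: h1|apply: h2]; rewrite /ball/= distrC.
exists r => // s s' Ts Ts' st s't sr s'r.
have [y [Ty yr ey]] := @MVT_on _ a b (fun v => G s v - G t v) (fun v => G01 s v - G01 t v) t s'
  (fun v Tv => has_deriv_onB (let: And4 _ h _ _ := dG s v Ts Tv in h)
     (let: And4 _ h _ _ := dG t v Tt Tv in h)) Tt Ts' ltac:(by rewrite eq_sym).
have [x [Tx xr ex]] := @MVT_on _ a b (fun u => G01 u y) (fun u => G11 u y) t s
  (fun u Tu => (let: And4 _ _ _ h := dG u y Tu Ty in h)) Tt Ts ltac:(by rewrite eq_sym).
have -> : (G s s' - G s t - G t s' + G t t) / ((s - t) * (s' - t)) = G11 x y.
  have -> : G s s' - G s t - G t s' + G t t = G11 x y * ((s - t) * (s' - t)).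
    by rewrite mulrA -ex -ey; ring.
  by rewrite mulfK// mulf_neq0// subr_eq0.
by apply/ltW/hr => //; [exact: le_lt_trans xr sr|exact: le_lt_trans yr s'r].
Qed.

Variables (X : R -> Omega -> R) (X1t : Omega -> R) (mu : R -> R) (G : R -> R -> R) (t m1 : R).
Hypotheses (hab : a < b) (Tt : T t) (hX2 : forall s, X s \in Lfun P 2%:E).
Hypotheses (X1t2 : X1t \in Lfun P 2%:E) (hmu : forall s, T s -> \int[P]_w X s w = mu s).
Hypothesis hG : forall s s', T s -> T s' -> covr P (X s) (X s') = G s s'.
Hypotheses (sG : smooth_kernel T G) (dmu : has_deriv_on T mu t m1).
Hypothesis hX1 : {ae P, forall w, has_deriv_on T (X ^~ w) t (X1t w)}.

Let D s w := (X s w - X t w) / (s - t).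

Let D2 s : D s \in Lfun P 2%:E.
Proof.
rewrite /D; under eq_fun do rewrite mulrC.
by apply: L2Z; exact: L2B.
Qed.

(** The first three terms form the variance of [D s - D s'] and the last one is
    the square of its mean. *)
Lemma quotient_dist s s' : T s -> T s' -> s != t -> s' != t ->
  \int[P]_w (D s w - D s' w) ^+ 2 =
  (G s s - G s t - G t s + G t t) / ((s - t) * (s - t))
  + (G s' s' - G s' t - G t s' + G t t) / ((s' - t) * (s' - t))
  - 2 * ((G s s' - G s t - G t s' + G t t) / ((s - t) * (s' - t)))
  + ((mu s - mu t) / (s - t) - (mu s' - mu t) / (s' - t)) ^+ 2.
Proof.
move=> Ts Ts' st s't.
have ED u : T u -> \int[P]_w D u w = (mu u - mu t) / (u - t).
  move=> Tu; rewrite RintegralZr//; last exact/L2_integrable/L2B.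
  by rewrite RintegralB ?hmu//; exact: L2_integrable.
have CD u v : T u -> T v -> covr P (D u) (D v) =
    (G u v - G u t - G t v + G t t) / ((u - t) * (v - t)).
  move=> Tu Tv.
  have DE z : D z = (fun w => (z - t)^-1 * (X z w - X t w)).
    by apply/funext => w; rewrite /D mulrC.
  have B2 z : (fun w => X z w - X t w) \in Lfun P 2%:E by exact: L2B.
  have ZB2 := L2Z (v - t)^-1 (B2 v).
  rewrite (DE u) (DE v) covrZl// covrZr// covrBl// !covrBr// !hG//.
  by rewrite invfM; ring.
rewrite mean_covr_sqr; last exact: L2B.
rewrite RintegralB//; [|exact: L2_integrable..].
rewrite covrBl ?covrBr//; last exact: L2B.
rewrite (covrC _ (D s') (D s)) !CD// !ED//.
ring.
Qed.

(** The mixed quotients, weighted [1], [1] and [-2], tend to the same limit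
    and the two mean quotients to [m1], so everything cancels. *)
Lemma quotient_cauchy e : 0 < e -> exists2 r, 0 < r &
  forall s s', T s -> T s' -> s != t -> s' != t -> `|s - t| < r -> `|s' - t| < r ->
    \int[P]_w (D s w - D s' w) ^+ 2 <= e.
Proof.
move=> e0; have [l hl] := mixed_quotient_cvg Tt sG.
(* Errors of e / 8 on the mixed quotients contribute (1 + 1 + 2) (e / 8); the means
   contribute 2 (e / 8) for each of the two points. *)
have [r r0 hr] := hl (e / 8) ltac:(lra).
have [r' r'0 hr'] : exists2 r', 0 < r' & forall s, T s -> s != t -> `|s - t| < r' ->
    ((mu s - mu t) / (s - t) - m1) ^+ 2 <= e / 8.
  have q0 : 0 < Num.sqrt (e / 8) by rewrite sqrtr_gt0; lra.
  move/cvgrPdist_lt: dmu => /(_ _ q0) h.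
  have {}h : \forall s \near nbhs t, s != t -> T s ->
    `|m1 - (mu s - mu t) / (s - t)| < Num.sqrt (e / 8) := h.
  case/nbhs_ballP: h => r' /= r'0 h; exists r' => // s Ts st sr.
  have := h s; rewrite /ball/= distrC => /(_ sr st Ts) hs.
  rewrite -[leRHS](@sqr_sqrtr _ (e / 8)); last lra.
  by rewrite -real_normK ?num_real// ler_pXn2r ?nnegrE ?sqrtr_ge0// distrC ltW.
exists (Num.min r r'); first by rewrite lt_min r0.
move=> s s' Ts Ts' st s't; rewrite !lt_min => /andP[sr sr'] /andP[s'r s'r'].
rewrite quotient_dist//.
have := hr s s Ts Ts st st sr sr; have := hr s' s' Ts' Ts' s't s't s'r s'r.
have := hr s s' Ts Ts' st s't sr s'r.
have := hr' s Ts st sr'; have := hr' s' Ts' s't s'r'.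
rewrite !ler_norml.
set x1 := _ / ((s - t) * (s - t)); set x2 := _ / ((s' - t) * (s' - t)).
set x3 := _ / ((s - t) * (s' - t)).
set y1 := (mu s - mu t) / (s - t); set y2 := (mu s' - mu t) / (s' - t).
move=> h1 h2 /andP[? ?] /andP[? ?] /andP[? ?].
have : (y1 - y2) ^+ 2 <= 2 * (y1 - m1) ^+ 2 + 2 * (y2 - m1) ^+ 2.
  have -> : 2 * (y1 - m1) ^+ 2 + 2 * (y2 - m1) ^+ 2 =
    (y1 - y2) ^+ 2 + (y1 + y2 - 2 * m1) ^+ 2 by ring.
  by rewrite lerDl sqr_ge0.
lra.
Qed.

Lemma exists_approach : exists v : nat -> R,
  [/\ forall n, T (v n), forall n, v n != t & v n @[n --> \oo] --> within T t^'].
Proof.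
suff [v [Tv vt cv]] : exists v : nat -> R,
    [/\ forall n, T (v n), forall n, v n != t & v n @[n --> \oo] --> t].
  exists v; split=> // A; rewrite /within/= => hA.
  have {}hA : \forall s \near nbhs t, s != t -> T s -> A s := hA.
  apply: (@filterS _ \oo _ (v @^-1` [set s | s != t -> T s -> A s])).
    by move=> n /= h; exact: h (vt n) (Tv n).
  exact: cv _ hA.
have [c Tc ct] : exists2 c, T c & c != t.
  move: Tt; rewrite /= in_itv/= => /andP[at_ tb].
  have [tb'|bt] := ltP t b.
    by exists b; rewrite /= ?in_itv/= ?lexx ?(ltW hab)// gt_eqF.
  exists a; rewrite /= ?in_itv/= ?lexx ?(ltW hab)// lt_eqF//.
  exact: lt_le_trans bt.
exists (fun n => t + (c - t) / n.+1%:R); split.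
- move=> n; have n1 : 0 <= (n.+1%:R^-1 : R) <= 1.
    by rewrite invr_ge0 ler0n/= invf_le1 ?ltr0n// ler1n.
  move: Tt Tc n1; set q := _^-1; rewrite /= !in_itv/=.
  move=> /andP[at_ tb] /andP[ac cb] /andP[q0 q1].
  have -> : t + (c - t) * q = t * (1 - q) + c * q by ring.
  by apply/andP; split; nra.
- by move=> n; rewrite -subr_eq0 addrAC subrr add0r mulf_neq0// subr_eq0.
- rewrite -[X in _ --> X]addr0 -(mulr0 (c - t)); apply: cvgD; first exact: cvg_cst.
  by apply: cvgM; [exact: cvg_cst|exact: cvg_harmonic].
Qed.

(** For a fixed [s], the bound of [quotient_cauchy] between [D s] and [D (v n)]
    passes to the limit in [n] by Fatou's lemma, and [D (v n)] tends to [X1t]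
    almost surely. *)
Lemma ms_derivative : ms_cvg P (within T t^') D X1t.
Proof.
split=> //; apply/cvgrPdist_le => e e0.
have [r r0 hr] := quotient_cauchy e0; have [v [Tv vt vT]] := exists_approach.
have cv : v n @[n --> \oo] --> t.
  move=> A tA; apply: vT; suff : \forall s \near nbhs t, s != t -> T s -> A s by [].
  by apply: filterS tA => s As _ _.
suff h : \forall s \near nbhs t, s != t -> T s ->
  `|0 - \int[P]_w (D s w - X1t w) ^+ 2| <= e by exact: h.
apply/nbhs_ballP; exists r => // s; rewrite /ball/= distrC => sr st Ts.
have iX1 := Lfun2_integrable_sqr (L2B (D2 s) X1t2).
have iD s' := Lfun2_integrable_sqr (L2B (D2 s) (D2 s')).
rewrite sub0r normrN ger0_norm; last by apply: Rintegral_ge0 => w _; exact: sqr_ge0.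
rewrite -lee_fin /Rintegral fineK; last exact: integrable_fin_num iX1.
pose f n w := ((D s w - D (v n) w) ^+ 2)%:E.
have mf n : measurable_fun setT (f n) by exact: measurable_int (iD (v n)).
have f0 n w : setT w -> (0 <= f n w)%E by move=> _; rewrite lee_fin sqr_ge0.
have hf := @fatou _ _ _ P _ measurableT f mf f0.
rewrite (_ : (\int[P]_x _)%E = (\int[P]_x limn_einf (f^~ x))%E); last first.
  apply: ae_eq_integral => //.
  - exact: measurable_int iX1.
  - under eq_fun do rewrite limn_einf_lim.
    apply: (emeasurable_fun_cvg (fun n x => einfs (f ^~ x) n)) => [n|w _].
      exact: measurable_fun_einfs.
    exact: is_cvg_einfs.
  - apply: filterS hX1 => w dw.
    have Dv : D (v n) w @[n --> \oo] --> X1t w := cvg_comp _ _ vT dw.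
    move=> _; have fw : f n w @[n --> \oo] --> ((D s w - X1t w) ^+ 2)%:E.
      apply: cvg_EFin; first exact: nearW.
      rewrite /comp/= expr2; under eq_fun do rewrite expr2.
      by apply: cvgM; apply: cvgB => //; exact: cvg_cst.
    by rewrite is_cvg_limn_einfE ?(cvg_lim _ fw)//; apply: cvgP fw.
apply: (le_trans hf); rewrite limn_einf_lim.
apply: lime_le; first exact: is_cvg_einfs.
move/cvgrPdist_lt: cv => /(_ _ r0)[M _ hM].
(* The infimum over indices at least n is bounded by the term of index
   maxn n M, for which v is already close to t. *)
apply: nearW => n; apply: (@le_trans _ _ (\int[P]_w f (maxn n M) w)%E).
  by apply: ereal_inf_lbound; exists (maxn n M) => //=; exact: leq_maxl.
have vr : `|v (maxn n M) - t| < r by rewrite distrC; apply: hM; exact: leq_maxr.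
have := hr s (v (maxn n M)) Ts (Tv _) st (vt _) sr vr.
by rewrite -lee_fin /Rintegral fineK//; exact: integrable_fin_num (iD _).
Qed.

End MeanSquareDerivative.

(** * Uncorrelated jointly normal variables *)
Section ProductProbability.
Context d1 d2 (T1 : measurableType d1) (T2 : measurableType d2) (R : realType).
Context (P1 : probability T1 R) (P2 : probability T2 R).

Definition product_probability := (P1 \x P2)%E.

HB.instance Definition _ := Measure.on product_probability.

Let product_probability_setT : product_probability setT = 1%E.
Proof.
rewrite -setXTT [LHS]product_measure1E//.
transitivity (1 * 1 : \bar R)%E; last exact: mule1.
by congr (_ * _)%E; exact: probability_setT.
Qed.

HB.instance Definition _ :=
  Measure_isProbability.Build _ _ _ product_probability product_probability_setT.

End ProductProbability.

Section Independence.
Context (R : realType) d (Omega : measurableType d) (P : probability Omega R).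

Lemma Rintegral_distribution (U : {RV P >-> R}) (f : R -> R) : measurable_fun setT f ->
  P.-integrable setT (EFin \o (fun w => f (U w))) ->
  \int[distribution P U]_x f x = \int[P]_w f (U w).
Proof.
move=> mf fi; rewrite /Rintegral; congr fine.
by rewrite (@integral_distribution _ _ _ _ _ P U (EFin \o f))//; exact/measurable_EFinP.
Qed.

(** With zero covariance the cosine transform of [(U, V)] is that of the product
    of the two laws, computed by Fubini; [charac_unique] in dimension two then
    identifies the joint law with the product. *)
Lemma uncorrelated_gaussian_independent (U V : {RV P >-> R}) :
  (forall c e, is_normal P (fun w => c * U w + e * V w)) ->
  covr P U V = 0 -> independent_RV U V.
Proof.
move=> UV cUV.
have nU : is_normal P U.
  have := UV 1 0; congr is_normal; apply/funext => w.
  by rewrite mul1r mul0r addr0.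
have nV : is_normal P V.
  have := UV 0 1; congr is_normal; apply/funext => w.
  by rewrite mul1r mul0r add0r.
have [U2 cU] := is_normal_charac (measurable_funPT U) nU.
have [V2 cV] := is_normal_charac (measurable_funPT V) nV.
set mU := Rintegral _ _ _ in cU; set mV := Rintegral _ _ _ in cV.
set vU := covr _ _ _ in cU; set vV := covr _ _ _ in cV.
have cUVE c e th : \int[P]_w cos (c * U w + e * V w + th) =
    cos (c * mU + e * mV + th) * expR (- (vU * c ^+ 2 / 2)) * expR (- (vV * e ^+ 2 / 2)).
  have cU2 := L2Z c U2; have eV2 := L2Z e V2.
  have [_ h] := is_normal_charac (Lfun_measurable (L2D cU2 eV2)) (UV c e).
  have := h 1 th; under eq_Rintegral do rewrite mul1r; move=> ->.
  rewrite RintegralD//; [|exact: L2_integrable..].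
  rewrite !RintegralZl//; [|exact: L2_integrable..].
  rewrite covrDl ?covrDr ?covrZl ?covrZr//; last exact: L2D.
  rewrite (covrC _ V U) cUV -/vU -/vV -/mU -/mV mul1r -[RHS]mulrA -expRD.
  by congr (_ * expR _); ring.
pose Q := product_probability (distribution P U) (distribution P V).
have mfst : measurable_fun setT (fst : R * R -> R) by exact: measurable_fst.
have msnd : measurable_fun setT (snd : R * R -> R) by exact: measurable_snd.
pose U' : {RV Q >-> R} := mfun_Sub (mem_set mfst).
pose V' : {RV Q >-> R} := mfun_Sub (mem_set msnd).
have QE c e th : \int[Q]_z cos (c * U' z + e * V' z + th) =
    \int[P]_w cos (c * U w + e * V w + th).
  have mlin (f : R -> R) k l : measurable_fun setT f ->
      measurable_fun setT (fun x => k * f x + l).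
    by move=> mf; apply: measurable_funD => //; exact: measurable_funM.
  rewrite cUVE.
  have iQ : Q.-integrable setT (EFin \o (fun z => cos (c * z.1 + e * z.2 + th))).
    by apply: integrable_cos_comp; apply: measurable_funD => //; apply: measurable_funD;
      apply: measurable_funM.
  pose k := expR (- (vV * e ^+ 2 / 2)).
  have inner x : (\int[distribution P V]_y (cos (c * x + e * y + th))%:E)%E =
      (k * cos (c * x + (e * mV + th)))%:E.
    have mf : measurable_fun setT (fun y : R => e * y + (c * x + th)) by exact: mlin.
    transitivity ((\int[distribution P V]_y cos (e * y + (c * x + th)))%:E).
      rewrite /Rintegral fineK; last exact: integrable_fin_num (integrable_cos_comp _ mf).
      by apply: eq_integral => y _; congr (cos _)%:E; ring.
    rewrite Rintegral_distribution; [|exact: measurable_cos_comp|]; last first.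
      by apply: integrable_cos_comp; apply: measurable_funD => //; exact: measurable_funM.
    by rewrite cV mulrC; congr (_ * cos _)%:E; ring.
  rewrite /Rintegral -(integral12_prod_meas1 iQ) /=.
  rewrite (eq_integral (fun x => (k * cos (c * x + (e * mV + th)))%:E)); last first.
    by move=> x _; exact: inner.
  have mf : measurable_fun setT (fun x : R => c * x + (e * mV + th)) by exact: mlin.
  rewrite -[fine _]/(\int[distribution P U]_x (k * cos (c * x + (e * mV + th)))).
  rewrite RintegralZl//; last exact: integrable_cos_comp.
  rewrite Rintegral_distribution; [|exact: measurable_cos_comp|]; last first.
    by apply: integrable_cos_comp; apply: measurable_funD => //; exact: measurable_funM.
  by rewrite cU /k addrA mulrC mulrA.
move=> A B mA mB.
pose Y2 i : {RV P >-> R} := if (i : 'I_2) == ord0 then U else V.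
pose Y2' i : {RV Q >-> R} := if (i : 'I_2) == ord0 then U' else V'.
pose AB := [set y : 2.-tuple R | A (tnth y ord0) /\ B (tnth y ord_max)].
have mAB : measurable AB.
  rewrite (_ : AB = ((fun y => tnth y ord0) @^-1` A) `&` ((fun y => tnth y ord_max) @^-1` B))//.
  by apply: measurableI; rewrite -[X in measurable X]setTI; exact: measurable_tnth.
have := @charac_unique _ 2 _ _ P _ _ Q Y2 Y2' _ _ mAB.
have -> : [set w | AB [tuple Y2 i w | i < 2]] = U @^-1` A `&` V @^-1` B.
  by apply/seteqP; split=> w /=; rewrite /AB/= !tnth_mktuple.
have -> : [set z | AB [tuple Y2' i z | i < 2]] = A `*` B.
  by apply/seteqP; split=> w /=; rewrite /AB/= !tnth_mktuple.
have QAB : Q (A `*` B) = (P (U @^-1` A) * P (V @^-1` B))%E.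
  exact: (product_measure1E (distribution P U) (distribution P V) mA mB).
move=> h; apply: etrans (h _) QAB => c th.
under eq_Rintegral do rewrite big_ord_recl big_ord1/=.
under [RHS]eq_Rintegral do rewrite big_ord_recl big_ord1/=.
exact/esym/QE.
Qed.

End Independence.

(** * Gaussian processes and their derivatives *)
Section GaussianProcess.
Context (R : realType) d (Omega : measurableType d) (P : probability Omega R).

Lemma is_normal_shift (f : Omega -> R) k : measurable_fun setT f ->
  is_normal P f -> is_normal P (fun w => f w + k).
Proof.
move=> mf nf; have [f2 fc] := is_normal_charac mf nf.
apply: (charac_is_normal (m := \int[P]_w f w + k) (v := covr P f f)).
- exact: measurable_funD.
- exact: covr_ge0.
move=> t th; rewrite mulrDr -addrA -fc; apply: eq_Rintegral => w _.
by congr cos; ring.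
Qed.

Lemma gaussian_process_L2 (T : set R) (Y : R -> {RV P >-> R}) t :
  gaussian_process T Y -> T t -> (Y t : Omega -> R) \in Lfun P 2%:E.
Proof.
move=> gY Tt; apply: (is_normal_charac (measurable_funPT (Y t)) _).1.
have := gY 1 (fun=> t) (fun=> 1) (fun=> Tt); congr is_normal.
by apply/funext => w; rewrite big_ord1 mul1r.
Qed.

Lemma gaussian_process_charac (T : set R) (Y : R -> {RV P >-> R}) (K : R -> R -> R) :
  gaussian_process T Y ->
  (forall t, T t -> 'E_P[Y t]%E = 0%E) ->
  (forall t s, T t -> T s -> covariance P (Y t) (Y s) = (K t s)%:E) ->
  forall (n : nat) (t c : 'I_n -> R) th, (forall i, T (t i)) ->
  \int[P]_w cos (\sum_i c i * Y (t i) w + th) =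
  cos th * expR (- (\sum_i \sum_j c i * c j * K (t i) (t j) / 2)).
Proof.
move=> gY EY KY n t c th Tt.
have Y2 i : (Y (t i) : Omega -> R) \in Lfun P 2%:E by exact: gaussian_process_L2 (Tt i).
have cY2 i := L2Z (c i) (Y2 i).
have S2 := L2sum (index_enum 'I_n) cY2.
have [_ /(_ 1 th)] := is_normal_charac (Lfun_measurable S2) (gY n t c Tt).
under eq_Rintegral do rewrite mul1r.
move=> ->.
have -> : \int[P]_w (\sum_i c i * Y (t i) w) = 0.
  rewrite Rintegral_sum_L2//; apply: big1 => i _.
  rewrite RintegralZl//; last exact: L2_integrable.
  by have := EY (t i) (Tt i); rewrite expectationR ?Lfun2_Lfun1// => -[->]; rewrite mulr0.
rewrite mulr0 add0r expr1n mulr1 covr_lin//; congr (_ * expR (- _)).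
rewrite mulr_suml; apply: eq_bigr => i _; rewrite mulr_suml; apply: eq_bigr => j _.
by rewrite /covr KY.
Qed.

End GaussianProcess.

Lemma same_mean_cov_same_laws (R : realType) (T : set R) (K : R -> R -> R)
    d (Omega : measurableType d) (P : probability Omega R)
    d' (Omega' : measurableType d') (P' : probability Omega' R)
    (Y : R -> {RV P >-> R}) (Y' : R -> {RV P' >-> R}) :
  gaussian_process T Y -> gaussian_process T Y' ->
  (forall t, T t -> 'E_P[Y t]%E = 0%E) -> (forall t, T t -> 'E_P'[Y' t]%E = 0%E) ->
  (forall t s, T t -> T s -> covariance P (Y t) (Y s) = (K t s)%:E) ->
  (forall t s, T t -> T s -> covariance P' (Y' t) (Y' s) = (K t s)%:E) ->
  same_finite_dim_laws T Y Y'.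
Proof.
move=> gY gY' EY EY' KY KY' n t Tt A mA.
apply: (charac_unique (Y := fun i => Y (t i)) (Y' := fun i => Y' (t i))) => // c th.
by rewrite (gaussian_process_charac gY EY KY)// (gaussian_process_charac gY' EY' KY').
Qed.

Section ProcessDerivative.
Context (R : realType) (a b : R) d (Omega : measurableType d) (P : probability Omega R).
Local Notation T := (`[a, b]%classic : set R).
Variables (X : R -> Omega -> R) (X1t : Omega -> R) (mu : R -> R) (G : R -> R -> R) (t m1 : R).
Hypotheses (hab : a < b) (Tt : T t) (hX2 : forall s, T s -> X s \in Lfun P 2%:E).
Hypotheses (X1t2 : X1t \in Lfun P 2%:E) (hmu : forall s, T s -> \int[P]_w X s w = mu s).
Hypothesis hG : forall s s', T s -> T s' -> covr P (X s) (X s') = G s s'.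
Hypotheses (sG : smooth_kernel T G) (dmu : has_deriv_on T mu t m1).
Hypothesis hX1 : {ae P, forall w, has_deriv_on T (X ^~ w) t (X1t w)}.

(** [ms_cvg] asks for square integrability at all indices, while [X] is only
    known to be square integrable on [T]; it is replaced by [0] elsewhere. *)
Lemma ms_derivative_on : exists2 D : R -> Omega -> R,
  forall s, T s -> D s = (fun w => (X s w - X t w) / (s - t)) &
  ms_cvg P (within T t^') D X1t.
Proof.
pose X' s := if `[< T s >] then X s else (fun=> 0).
have X'E s : T s -> X' s = X s by move=> Ts; rewrite /X' asboolT.
exists (fun s w => (X' s w - X' t w) / (s - t)).
  by move=> s Ts; rewrite !X'E.
apply: (@ms_derivative _ a b _ _ _ X' X1t mu G t m1) => //.
- by move=> s; rewrite /X'; case: asboolP => [/hX2//|_]; exact: L2cst.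
- by move=> s Ts; rewrite X'E ?hmu.
- by move=> s s' Ts Ts'; rewrite !X'E ?hG.
- apply: filterS hX1 => w; rewrite /has_deriv_on => h.
  apply: cvg_trans h; apply: near_eq_cvg.
  suff : \forall s \near nbhs t, s != t -> T s ->
    (X s w - X t w) / (s - t) = (X' s w - X' t w) / (s - t) by [].
  by apply: nearW => s _ Ts; rewrite !X'E.
Qed.

Lemma derivative_mean : \int[P]_w X1t w = m1.
Proof.
have [D DE msD] := ms_derivative_on.
have [v [Tv vt vT]] := exists_approach hab Tt.
have c1 : \int[P]_w D (v n) w @[n --> \oo] --> \int[P]_w X1t w.
  apply: (cvg_comp v (fun s => \int[P]_w D s w) vT).
  exact: ms_cvg_mean.
have c2 : (mu (v n) - mu t) / (v n - t) @[n --> \oo] --> m1 := cvg_comp _ _ vT dmu.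
rewrite -(cvg_lim (@Rhausdorff R) c1) -(cvg_lim (@Rhausdorff R) c2).
congr (limn _); apply/funext => n; rewrite DE//.
have [Xv Xt] := (hX2 (Tv n), hX2 Tt).
rewrite RintegralZr//; last exact/L2_integrable/L2B.
by rewrite RintegralB ?hmu//; exact: L2_integrable.
Qed.

(** Writing [X s = X t + (s - t) * D s], the difference quotient of the variance
    is [2 cov (D s) (X t) + (s - t) * var (D s)], and [D s] tends to [X1t] in
    mean square. *)
Lemma variance_derivative :
  has_deriv_on T (fun s => covr P (X s) (X s)) t (2 * covr P X1t (X t)).
Proof.
have [D DE msD] := ms_derivative_on.
have h : 2 * covr P (D s) (X t) + (s - t) * covr P (D s) (D s) @[s --> within T t^'] -->
    2 * covr P X1t (X t) + 0 * covr P X1t X1t.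
  apply: cvgD.
    by apply: cvgM; [exact: cvg_cst|apply: ms_cvg_covr => //; exact: hX2].
  apply: cvgM; last exact: ms_cvg_var.
  apply/subr_cvg0; apply: cvg_trans (@cvg_id _ (nbhs t)).
  by apply: cvg_within_filter; apply: cvg_within.
rewrite mul0r addr0 in h; apply: cvg_trans h; apply: near_eq_cvg.
suff : \forall s \near nbhs t, s != t -> T s ->
  2 * covr P (D s) (X t) + (s - t) * covr P (D s) (D s) =
  (covr P (X s) (X s) - covr P (X t) (X t)) / (s - t) by [].
apply: nearW => s st Ts.
have [Xs Xt] := (hX2 Ts, hX2 Tt); have D2 : D s \in Lfun P 2%:E by case: msD.
have -> : X s = (fun w => X t w + (s - t) * D s w).
  by apply/funext => w; rewrite DE// mulrC divfK ?subr_eq0// addrC subrK.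
have ZD2 := L2Z (s - t) D2.
rewrite covrDl ?covrDr ?covrZl ?covrZr//; last exact: L2D.
by rewrite (covrC _ (X t) (D s)); field; rewrite subr_eq0.
Qed.

End ProcessDerivative.

(** Replacing each [X1 (t i)] by a difference quotient leaves a combination of
    values of [X], which is normal; the quotients converge in mean square. *)
Lemma gaussian_with_derivative (R : realType) d (Omega : measurableType d)
    (P : probability Omega R) (T : set R) (X : R -> {RV P >-> R}) (X1 : R -> Omega -> R) :
  gaussian_process T X ->
  (forall t, T t -> exists2 v : nat -> R, forall n, T (v n) &
    ms_cvg P \oo (fun n w => (X (v n) w - X t w) / (v n - t)) (X1 t)) ->
  forall n (t c e : 'I_n -> R) k, (forall i, T (t i)) ->
  is_normal P (fun w => \sum_i (c i * X1 (t i) w + e i * X (t i) w) + k).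
Proof.
move=> gX hX1 n t c e k Tt.
have X2 i : (X (t i) : Omega -> R) \in Lfun P 2%:E by exact: gaussian_process_L2 (Tt i).
have /choice[v /all_and2[Tv msv]] : forall i, exists v : nat -> R, (forall n, T (v n)) /\
    ms_cvg P \oo (fun n w => (X (v n) w - X (t i) w) / (v n - t i)) (X1 (t i)).
  by move=> i; have [v Tv msv] := hX1 _ (Tt i); exists v.
pose D i m w := (X (v i m) w - X (t i) w) / (v i m - t i).
have ms : ms_cvg P \oo (fun m w => \sum_i (c i * D i m w + e i * X (t i) w))
    (fun w => \sum_i (c i * X1 (t i) w + e i * X (t i) w)).
  apply: (@ms_cvg_sum _ _ _ P _ _ _ _ _ (fun i m w => c i * D i m w + e i * X (t i) w)
    (fun i w => c i * X1 (t i) w + e i * X (t i) w)) => i.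
  apply: ms_cvgD; apply: ms_cvgZ; first exact: msv.
  exact: ms_cvg_cst.
apply: is_normal_shift; first by case: ms => _ /Lfun_measurable.
apply: (ms_limit_normal ms) => m.
(* The quotient at t i uses the points v i m and t i, with coefficients q i and
   - q i: this makes 2n points in all. *)
pose q i := c i / (v i m - t i).
pose t' (j : 'I_(n + n)) := match fintype.split j with inl i => v i m | inr i => t i end.
pose c' (j : 'I_(n + n)) := match fintype.split j with inl i => q i | inr i => e i - q i end.
have Tt' j : T (t' j) by rewrite /t'; case: (fintype.split j) => i.
have := gX _ t' c' Tt'; congr is_normal; apply/funext => w.
rewrite big_split_ord/= -big_split/=; apply: eq_bigr => i _.
rewrite /t' /c' (unsplitK (inl i)) (unsplitK (inr i)) /q /D.
ring.
Qed.

(** The properties of the mean-square derivative, applied at every [t], turn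
    the claims on [beta] and [Z] into identities between means and
    covariances. *)
Theorem theorem1 (R : realType) (d : measure_display)
    (Omega : measurableType d) (P : probability Omega R)
    (a b : R) (hab : a < b) (T : set R) (hT : T = `[a, b]%classic)
    (X X1 : R -> {RV P >-> R}) (mu mu1 : R -> R) (G : R -> R -> R)
    (lambda : nat -> R) (phi phi1 : nat -> R -> R) (xi : nat -> {RV P >-> R})
    (hX2 : forall t, T t -> (X t : Omega -> R) \in Lfun P 2%:E)
    (hX12 : forall t, T t -> (X1 t : Omega -> R) \in Lfun P 2%:E)
    (hmu : forall t, T t -> 'E_P[X t]%E = (mu t)%:E)
    (hG : forall t s, T t -> T s -> covariance P (X t) (X s) = (G t s)%:E)
    (hGsmooth : smooth_kernel T G)
    (hGsym : symmetric_kernel T G)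
    (hGnneg : nonneg_definite_kernel T G)
    (hspec : simple_spectrum T G lambda phi)
    (hlambda : cvgn (series lambda))
    (hKL : karhunen_loeve T X mu lambda phi xi)
    (hderiv : termwise_derivative T X X1 mu mu1 lambda phi phi1 xi)
    (hvar : forall t, T t -> 0 < var (X t))
    (hgauss : gaussian_process T X) :
  (forall t, T t ->
     beta X X1 t = ksum lambda phi1 phi t t / ksum lambda phi phi t t /\
     exists l, has_deriv_on T (fun s => ln (var (X s))) t l /\
               beta X X1 t = 2^-1 * l) /\
  exists Z : R -> {RV P >-> R},
    [/\ forall t, T t -> forall w,
          X1 t w - mu1 t = beta X X1 t * (X t w - mu t) + Z t w,
        gaussian_process T Z,
        forall t, T t -> independent_RV (Z t) (X t),
        (forall t, T t -> 'E_P[Z t]%E = 0%E) /\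
        (forall t s, T t -> T s ->
           covariance P (Z t) (Z s) =
             (Gz (beta X X1) lambda phi phi1 t s)%:E) &
        forall (d' : measure_display) (Omega' : measurableType d')
          (P' : probability Omega' R) (Z' : R -> {RV P' >-> R}),
          gaussian_process T Z' ->
          (forall t, T t -> 'E_P'[Z' t]%E = 0%E) ->
          (forall t s, T t -> T s ->
             covariance P' (Z' t) (Z' s) =
               (Gz (beta X X1) lambda phi phi1 t s)%:E) ->
          same_finite_dim_laws T Z Z'].
Proof.
have [hX1 dmu _ _ hcov] := hderiv.
have ksumE (nu1 nu2 : bool) t s : T t -> T s ->
    ksum lambda (if nu1 then phi1 else phi) (if nu2 then phi1 else phi) t s =
    covr P ((if nu1 then X1 else X) t) ((if nu2 then X1 else X) s).
  move=> Tt Ts; have := hcov nu1 nu2 t s Tt Ts.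
  by case: nu1; case: nu2 => h; rewrite /ksum (cvg_lim (@Rhausdorff R) h).
have k00 t s (Tt : T t) (Ts : T s) := ksumE false false t s Tt Ts.
have k01 t s (Tt : T t) (Ts : T s) := ksumE false true t s Tt Ts.
have k10 t s (Tt : T t) (Ts : T s) := ksumE true false t s Tt Ts.
have k11 t s (Tt : T t) (Ts : T s) := ksumE true true t s Tt Ts.
rewrite /= in k00 k01 k10 k11.
have hm t : T t -> \int[P]_w X t w = mu t.
  by move=> Tt; have := hmu t Tt; rewrite expectationR ?Lfun2_Lfun1 ?hX2// => -[].
have hc t s : T t -> T s -> covr P (X t) (X s) = G t s.
  by move=> Tt Ts; rewrite /covr hG.
have hX1t t : T t -> {ae P, forall w, has_deriv_on T (X ^~ w) t (X1 t w)}.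
  by move=> Tt; apply: filterS hX1 => w; apply.
set be := beta X X1.
subst T.
have hm1 t : `[a, b]%classic t -> \int[P]_w X1 t w = mu1 t.
  move=> Tt; exact: (derivative_mean hab Tt hX2 (hX12 t Tt) hm hc hGsmooth (dmu t Tt) (hX1t t Tt)).
split.
  move=> t Tt; split; first by rewrite k10// k00.
  exists (2 * covr P (X1 t) (X t) / var (X t)); split; last first.
    by rewrite /beta mulrA mulKf.
  apply: has_deriv_on_ln => //; first exact: hvar.
  exact: (variance_derivative hab Tt hX2 (hX12 t Tt) hm hc hGsmooth (dmu t Tt) (hX1t t Tt)).
have joint n (t c e : 'I_n -> R) k : (forall i, `[a, b]%classic (t i)) ->
    is_normal P (fun w => \sum_i (c i * X1 (t i) w + e i * X (t i) w) + k).
  apply: (gaussian_with_derivative (X1 := X1) hgauss) => u Tu.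
  have [D DE msD] := ms_derivative_on hab Tu hX2 (hX12 u Tu) hm hc hGsmooth (dmu u Tu) (hX1t u Tu).
  have [v [Tv vt vT]] := exists_approach hab Tu.
  exists v => //; have := ms_cvg_comp vT msD; congr ms_cvg.
  by apply/funext => m; rewrite DE.
have mZ t : measurable_fun setT (fun w => X1 t w - mu1 t - be t * (X t w - mu t)).
  by apply: measurable_funB; [|apply: measurable_funM => //]; exact: measurable_funB.
pose Z t : {RV P >-> R} := mfun_Sub (mem_set (mZ t)).
exists Z.
have ZE t w : Z t w = X1 t w - mu1 t - be t * (X t w - mu t) by [].
have Z2 t : `[a, b]%classic t -> (Z t : Omega -> R) \in Lfun P 2%:E.
  move=> Tt; apply: L2B; first exact: L2B (hX12 t Tt) (L2cst P _).
  by apply: L2Z; exact: L2B (hX2 t Tt) (L2cst P _).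
have gZ : gaussian_process `[a, b]%classic Z.
  move=> n t c Tt.
  have := joint n t c (fun i => - (c i * be (t i)))
    (\sum_i c i * (be (t i) * mu (t i) - mu1 (t i))) Tt.
  congr is_normal; apply/funext => w; rewrite -big_split/=; apply: eq_bigr => i _.
  by rewrite ?ZE /=; ring.
have EZ t : `[a, b]%classic t -> 'E_P[Z t]%E = 0%E.
  move=> Tt; rewrite expectationR; last exact/Lfun2_Lfun1/Z2.
  have i1 := L2_integrable (hX12 t Tt); have i2 := L2_integrable (hX2 t Tt).
  have i3 c := L2_integrable (L2cst P c).
  have i4 := L2_integrable (L2B (hX12 t Tt) (L2cst P (mu1 t))).
  have i5 := L2B (hX2 t Tt) (L2cst P (mu t)).
  rewrite RintegralB//; last exact: L2_integrable (L2Z _ i5).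
  rewrite RintegralZl//; last exact: L2_integrable i5.
  by rewrite !RintegralB// hm1// hm// !Rintegral_probability_cst !subrr mulr0 subr0.
have cZ t h : `[a, b]%classic t -> h \in Lfun P 2%:E ->
    covr P (Z t) h = covr P (X1 t) h - be t * covr P (X t) h.
  move=> Tt h2; have [Xt X1t] := (hX2 t Tt, hX12 t Tt).
  have i5 := L2B Xt (L2cst P (mu t)); have i4 := L2B X1t (L2cst P (mu1 t)).
  rewrite covrBl ?covrZl//; last exact: L2Z.
  by rewrite !covrBl ?L2cst// !covr_cstl !subr0.
have cZZ t s : `[a, b]%classic t -> `[a, b]%classic s ->
    covariance P (Z t) (Z s) = (Gz be lambda phi phi1 t s)%:E.
  move=> Tt Ts; rewrite covarianceR ?Z2//; congr (_%:E).
  rewrite cZ ?Z2// (covrC _ (X1 t)) (covrC _ (X t)) !cZ ?hX2 ?hX12//.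
  rewrite /Gz k11// k01// k10// k00// !(covrC _ (X1 s)) !(covrC _ (X s)).
  ring.
split => //.
- by move=> t Tt w; rewrite ?ZE /=; ring.
- move=> t Tt; apply: uncorrelated_gaussian_independent.
  + move=> c e.
    have := joint 1%N (fun=> t) (fun=> c) (fun=> e - c * be t)
      (c * (be t * mu t - mu1 t)) (fun=> Tt).
    by congr is_normal; apply/funext => w; rewrite big_ord1 ?ZE /=; ring.
  (* This is where the choice of beta enters. *)
  + rewrite cZ ?hX2// /be /beta -[cov _ _]/(covr P (X1 t) (X t)).
    by rewrite divfK ?subrr// gt_eqF//; exact: hvar.
- by move=> d' Omega' P' Z' gZ' EZ' cZ'; exact: same_mean_cov_same_laws gZ gZ' EZ EZ' cZZ cZ'.
Qed.
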